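(* Let $m,n\ge 1$ be integers. Let $\pi$ be an irreducible finite dimensional (algebraic) representation of $\mathrm{GL}_{mn}(\mathbb{C})$ with character $\Theta_\pi$ and highest weight $\underline{\lambda}=(\lambda_1\ge\lambda_2\ge\cdots\ge\lambda_{mn})$, $\lambda_j\in\mathbb{Z}$. Let $\underline{\delta}_{mn}=(mn-1,mn-2,\ldots,1,0)$. (1) The function $t\mapsto\Theta_\pi(t\cdot c_n)$ on $\mathrm{GL}_m(\mathbb{C})$ is not identically zero if and only if the $mn$ integers which are the entries of $\underline{\lambda}+\underline{\delta}_{mn}$ represent each residue class in $\mathbb{Z}/n$ exactly $m$ times. (2) Assume that the entries of $\underline{\lambda}+\underline{\delta}_{mn}$ represent each residue class in $\mathbb{Z}/n$ exactly $m$ times. For each $0\le i<n$, let $\pi_i$ be the irreducible representation of $\mathrm{GL}_m(\mathbb{C})$ with highest weight $\underline{\mu}_i$, where $\underline{\mu}_i$ is such that the entries of $\underline{\mu}_i+\underline{\delta}_m$ (with $\underline{\delta}_m=(m-1,m-2,\ldots,1,0)$) are exactly the integers (there are exactly $m$ of them) among the $mn$ rational numbers $\frac{1}{n}(a-i)$, where $a$ runs over the entries of $\underline{\lambda}+\underline{\delta}_{mn}$, arranged in decreasing order. Let $\Theta_i$ be the character of $\pi_i$. Then there is a sign $\varepsilon\in\{1,-1\}$ such that for all $t\in\mathrm{GL}_m(\mathbb{C})$, $$\Theta_\pi(t\cdot c_n)=\varepsilon\,\Theta_0(t^n)\,\Theta_1(t^n)\cdots\Theta_{n-1}(t^n).$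$
   Context: Highest weights of $\mathrm{GL}_N(\mathbb{C})$ are taken with respect to the diagonal torus and the upper triangular Borel subgroup, and are identified with non-increasing $N$-tuples of integers. The element $c_n\in\mathrm{GL}_n(\mathbb{C})$ denotes (a representative of) the Coxeter conjugacy class, namely the conjugacy class of the permutation matrix of an $n$-cycle; equivalently, the class of the diagonal matrix whose diagonal entries are all the $n$-th roots of unity $1,\omega,\ldots,\omega^{n-1}$, each with multiplicity one, where $\omega$ is a primitive $n$-th root of unity. Let $\iota:\mathrm{GL}_m(\mathbb{C})\times\mathrm{GL}_n(\mathbb{C})\to\mathrm{GL}_{mn}(\mathbb{C})$ be the natural homomorphism obtained from the tensor product $\mathbb{C}^m\otimes\mathbb{C}^n\cong\mathbb{C}^{mn}$. For $t\in\mathrm{GL}_m(\mathbb{C})$, write $t\cdot c_n$ for $\iota(t,c_n)\in\mathrm{GL}_{mn}(\mathbb{C})$. Thus if $t$ is diagonal with entries $t_1,\ldots,t_m$, then $t\cdot c_n$ is conjugate to the diagonal matrix with entries $t_i\omega^j$, $1\le i\le m$, $0\le j<n$. *)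

(* Defs.v *)
From mathcomp Require Import all_boot all_order all_fingroup all_algebra.
From mathcomp Require Import complex mxtens mpoly reals.

Set Implicit Arguments.
Unset Strict Implicit.
Unset Printing Implicit Defensive.

Import Order.TTheory GRing.Theory Num.Theory.
Local Open Scope ring_scope.

(* A finite dimensional algebraic representation of GL_N(C) on column vectors
   of size [gl_dim], acting from the left.  GL_N(C) is the set [unitmx] of
   invertible matrices: the values of [gl_act] on singular matrices are
   irrelevant.  [gl_regular] says that the matrix coefficients are elements of
   the coordinate ring C[g_11, ..., g_NN, 1/det g]. *)
Record gl_rep (C : fieldType) (N : nat) := GLRep {
  gl_dim : nat;
  gl_act :> 'M[C]_N -> 'M[C]_gl_dim;
  gl_act1 : gl_act 1%:M = 1%:M;
  gl_actM : {in unitmx &, {morph gl_act : g h / g *m h}};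
  gl_regular : forall i j, exists (p : {mpoly C[N * N]}) (k : nat),
    forall g, g \in unitmx ->
      gl_act g i j = p.@[fun l => mxvec g 0 l] / (\det g) ^+ k
}.

Definition gl_character (C : fieldType) (N : nat) (rho : gl_rep C N)
  (g : 'M[C]_N) : C := \tr (rho g).

Definition gl_irreducible (C : fieldType) (N : nat) (rho : gl_rep C N) : Prop :=
  (0 < gl_dim rho)%N /\
  forall W : {vspace 'cV[C]_(gl_dim rho)},
    (forall g v, g \in unitmx -> v \in W -> rho g *m v \in W) ->
    W = 0%VS \/ W = fullv.

Definition non_increasing (N : nat) (lam : 'I_N -> int) : Prop :=
  forall i j : 'I_N, (i <= j)%N -> lam j <= lam i.

(* [is_trig_mx] is lower triangularity, hence the transpose. *)
Definition has_highest_weight (C : fieldType) (N : nat) (rho : gl_rep C N)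
  (lam : 'I_N -> int) : Prop :=
  non_increasing lam /\
  exists2 v : 'cV[C]_(gl_dim rho), v != 0 &
    forall b : 'M[C]_N, b \in unitmx -> is_trig_mx b^T ->
      rho b *m v = (\prod_i b i i ^ lam i) *: v.

Definition delta (N : nat) (j : 'I_N) : int := Posz (N.-1 - j)%N.

Definition shifted_entries (N : nat) (lam : 'I_N -> int) : seq int :=
  [seq lam j + delta j | j : 'I_N].

Definition equidistributed (m n : nat) (s : seq int) : Prop :=
  forall r : 'I_n, count (fun a => (a == r %[mod n])%Z) s = m.

(* For s the entries of lam + delta: the rational numbers (a - i) / n, a in s,
   that happen to be integers. *)
Definition integral_quotients (n i : nat) (s : seq int) : seq rat :=
  [seq q <- [seq (a - i%:Z)%:Q / n%:Q | a <- s] | q \is a Num.int].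

(* [sort >=%R] sorts in decreasing order. *)
Definition is_quotient_weight (m n i : nat) (s : seq int) (mu : 'I_m -> int) :
  Prop :=
  [seq a%:Q | a <- shifted_entries mu] = sort >=%R (integral_quotients n i s).

Definition coxeter_mx (C : fieldType) (n : nat) : 'M[C]_n :=
  perm_mx (perm (@ordS_inj n)).

(* The conjugacy class in GL_n(C) of the permutation matrix of an n-cycle. *)
Definition coxeter_class (C : fieldType) (n : nat) (c : 'M[C]_n) : Prop :=
  exists2 P : 'M[C]_n, P \in unitmx & c = P *m coxeter_mx C n *m invmx P.

(* Main.v *)
(* The Weyl character formula on the diagonal torus is first obtained from the
   Casimir element: it acts on the irreducible representation by a scalar, and
   evaluating its trace against a diagonal matrix shows that the product f of the
   character with the Vandermonde alternant is an eigenvector of the torus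
   Laplacian for the eigenvalue |lambda + delta|^2.  Since f is antisymmetric and
   all its exponents are dominated by lambda + delta, it must be the alternant of
   lambda + delta.
   At the diagonal matrix with entries t_i w_a, where the w_a are the n-th roots
   of unity, the alternant of exponents e_c is the determinant of a product of the
   discrete Fourier matrix with a matrix that is nonzero only where the residue
   of e_c modulo n is the row index; it is therefore zero unless the residues are
   equidistributed, and otherwise it is, up to sign and to a factor independent
   of e, a product of n alternants in the t_i^n.  Dividing by the same
   formula for delta gives the theorem on generic diagonal matrices, hence
   everywhere, both sides being regular class functions. *)

From HB Require Import structures.
Require Import Defs.
From mathcomp Require Import all_boot all_order all_fingroup all_algebra.
From mathcomp Require Import complex mxtens mpoly reals.
From mathcomp Require Import boolp separable cyclotomic ring zify.

Set Implicit Arguments.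
Unset Strict Implicit.
Unset Printing Implicit Defensive.

Import Order.TTheory GRing.Theory Num.Theory.
Local Open Scope ring_scope.

(** * Polynomials along curves *)

(** Everything infinitesimal is done with polynomial curves: the derived representation is the
    coefficient of s in rho(1 + s A), and identities in s are checked where the curve is invertible,
    then extended because they are polynomial. This requires polynomial matrix coefficients, hence a
    twist by a power of the determinant, undone once the character formula is known. The domination
    of exponents comes from a degeneration. Conjugating a lower unitriangular u by diag(t_i
    s^(-a_i)), with a strictly decreasing, drives u to 1 as s tends to 0, which bounds the weights
    of rho(u) v; these vectors span because the big cell is dense. The resulting bound is for the
    linear functional a, and it is proved for every a: a stray exponent nu with |nu| = |lambda +
    delta| is excluded by taking a = nu + lambda + delta. The passage from diagonal matrices to all
    of GL_m does not go through diagonalizable matrices: Schur triangularization, followed by the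
    same kind of degeneration, brings a regular class function back to the torus. *)

Lemma poly_eval_eq0 (F : numDomainType) (p : {poly F}) :
  (forall s, p.[s] = 0) -> p = 0.
Proof.
move=> p0; apply/eqP; apply: contraT => pn0.
have := max_poly_roots pn0 (rs := [seq i%:R | i <- iota 0 (size p)]).
rewrite size_map size_iota ltnn; apply.
  by apply/allP => x _; rewrite /root p0.
by rewrite map_inj_uniq ?iota_uniq // => i j /eqP; rewrite eqr_nat => /eqP.
Qed.

(** [(p - q) * r] vanishes at every point, and [r] cancels. Typically [r] is the determinant of a
    curve, so that multiplicativity of a representation is invoked only at invertible points. *)
Lemma poly_eq_generic (F : numDomainType) (r p q : {poly F}) :
  r != 0 -> (forall s, r.[s] != 0 -> p.[s] = q.[s]) -> p = q.
Proof.
move=> rn0 pq; apply/eqP; rewrite -subr_eq0.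
have : (p - q) * r = 0.
  apply: poly_eval_eq0 => s; rewrite hornerM hornerD hornerN.
  have [->|/pq ->] := eqVneq r.[s] 0; first by rewrite mulr0.
  by rewrite subrr mul0r.
by move/eqP; rewrite mulf_eq0 (negPf rn0) orbF.
Qed.

Section MpolyCurves.
Variables (F : numDomainType) (n : nat).
Implicit Types (p q : {mpoly F[n]}) (h : 'I_n -> {poly F}).

Lemma mpoly_alg_ind (S : {mpoly F[n]} -> Prop) :
  (forall c, S c%:MP) -> (forall i, S 'X_i) ->
  (forall p q, S p -> S q -> S (p + q)) ->
  (forall p q, S p -> S q -> S (p * q)) -> forall p, S p.
Proof.
move=> SC SX SD SM p; rewrite [p]mpolyE.
apply: (big_ind S) => [||m _]; [by rewrite -mpolyC0 | exact: SD |].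
rewrite -mul_mpolyC; apply: (SM) => //; rewrite mpolyXE_id.
apply: (big_ind S) => [||i _]; [by rewrite -mpolyC1 | exact: SM |].
elim: (m i) => [|k IH]; first by rewrite expr0 -mpolyC1.
by rewrite exprS; apply: SM.
Qed.

Lemma horner_mmap h p s : (mmap polyC h p).[s] = p.@[fun i => (h i).[s]].
Proof.
elim/mpoly_alg_ind: p => [c|i|p q IHp IHq|p q IHp IHq].
- by rewrite mmapC mevalC hornerC.
- by rewrite mmapX mmap1U mevalXU.
- by rewrite mmapD mevalD hornerD IHp IHq.
by rewrite rmorphM mevalM hornerM IHp IHq.
Qed.

(** Chain rule: both sides are derivations over the substitution morphism, so constants and
    variables suffice. *)
Lemma deriv_mmap h p :
  (mmap polyC h p)^`() = \sum_i mmap polyC h p^`M(i) * (h i)^`().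
Proof.
elim/mpoly_alg_ind: p => [c|i|p q IHp IHq|p q IHp IHq].
- rewrite mmapC derivC big1 // => i _.
  by rewrite mderivC mmap0 mul0r.
- rewrite mmapX mmap1U (bigD1 i) //= big1 => [|j /negPf ji].
    rewrite mderivX mnm1E eqxx -{1}[U_(i)%MM]add0m addmK mpolyX0 scale1r.
    by rewrite rmorph1 mul1r addr0.
  by rewrite mderivX mnm1E eq_sym ji scale0r mmap0 mul0r.
- rewrite mmapD derivD IHp IHq -big_split; apply: eq_bigr => i _ /=.
  by rewrite mderivD mmapD mulrDl.
rewrite rmorphM derivM IHp IHq /= mulr_suml mulr_sumr -big_split.
apply: eq_bigr => i _ /=; rewrite mderivM mmapD !rmorphM /=; ring.
Qed.

Lemma meval_curve_deriv h p s :
  (mmap polyC h p)^`().[s]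
  = \sum_i p^`M(i).@[fun j => (h j).[s]] * (h i)^`().[s].
Proof.
rewrite deriv_mmap horner_sum; apply: eq_bigr => i _.
by rewrite hornerM horner_mmap.
Qed.

(** Restriction to coordinate lines shows that the partial derivatives of a vanishing function
    vanish. Hence all iterated derivatives vanish at 0, where the one of multi-order m is m! times
    the coefficient of X^m. *)
Lemma mpoly_eval_eq0 p : (forall v, p.@[v] = 0) -> p = 0.
Proof.
move=> p0; apply/mpolyP => m; rewrite mcoeff0.
have der0 q i : (forall v, q.@[v] = 0) -> forall v, q^`M(i).@[v] = 0.
  move=> q0 v; pose h j : {poly F} := (v j)%:P + (i == j)%:R *: 'X.
  have h0 : (fun j => (h j).[0]) =1 v.
    by move=> j; rewrite /h hornerD hornerC hornerZ hornerX mulr0 addr0.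
  have qh : mmap polyC h q = 0.
    by apply: poly_eval_eq0 => s; rewrite horner_mmap.
  have := meval_curve_deriv h q 0; rewrite qh deriv0 horner0.
  rewrite (bigD1 i) //= big1 => [|j /negPf ji]; last first.
    by rewrite /h eq_sym ji scale0r addr0 derivC horner0 mulr0.
  rewrite /h eqxx scale1r derivD derivC derivX add0r hornerC mulr1 addr0.
  by rewrite (meval_eq _ h0) => <-.
have dm0 : forall v, p^`M[m].@[v] = 0.
  rewrite mderivm_foldr; elim: (enum _) => [|i s IH] //= v.
  elim: (m i) v => [|k IHk] v //=; exact: der0.
have := mcoeff_mderivm m p 0; rewrite addm0.
have -> q : q@_0%MM = q.@[fun=> 0].
  elim/mpoly_alg_ind: q => [c|i|q r IHq IHr|q r IHq IHr].
  - by rewrite mcoeffC eqxx mulr1 mevalC.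
  - by rewrite mcoeffX mevalXU mnm1_eq0.
  - by rewrite mcoeffD IHq IHr mevalD.
  by rewrite mevalM -IHq -IHr; apply: (rmorphM (mcoeff 0%MM)).
rewrite dm0 => /esym/eqP; rewrite mulrn_eq0 => /orP[|/eqP//].
by rewrite eqn0Ngt prodn_gt0 // => i; rewrite ffact_gt0.
Qed.
End MpolyCurves.

Lemma sum_ltn_r (n i : nat) : (\sum_(j < n) (i < j) = n - i.+1)%N.
Proof. by elim: n => [|n IH]; rewrite ?big_ord0 // big_ord_recr /= IH; lia. Qed.

Lemma sum_ltn_l (n i : nat) : (\sum_(j < n) (j < i) = minn n i)%N.
Proof.
by elim: n => [|n IH]; rewrite ?big_ord0 ?min0n // big_ord_recr /= IH; lia.
Qed.

(** * Values and velocities of polynomial curves of matrices *)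

Section Jets.
Variable F : numFieldType.

Definition mx_at m n (s : F) (G : 'M[{poly F}]_(m, n)) : 'M[F]_(m, n) :=
  map_mx (fun p : {poly F} => p.[s]) G.

Definition jet1 m n (G : 'M[{poly F}]_(m, n)) : 'M[F]_(m, n) :=
  map_mx (fun p : {poly F} => p^`().[0]) G.

Lemma mx_atM m n k s (G : 'M[{poly F}]_(m, n)) (H : 'M_(n, k)) :
  mx_at s (G *m H) = mx_at s G *m mx_at s H.
Proof.
apply/matrixP => i j; rewrite !mxE horner_sum; apply: eq_bigr => l _.
by rewrite !mxE hornerM.
Qed.

Lemma mx_at_polyC m n s (A : 'M[F]_(m, n)) : mx_at s (map_mx polyC A) = A.
Proof. by apply/matrixP => i j; rewrite !mxE hornerC. Qed.

Lemma det_mx_at n s (G : 'M[{poly F}]_n) : \det (mx_at s G) = (\det G).[s].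
Proof. exact: (det_map_mx (horner_eval s)). Qed.

Lemma mx_at_eq_generic m n (r : {poly F}) (G H : 'M[{poly F}]_(m, n)) :
  r != 0 -> (forall s, r.[s] != 0 -> mx_at s G = mx_at s H) -> G = H.
Proof.
move=> rn0 GH; apply/matrixP => i j; apply: (poly_eq_generic rn0) => s rs.
by have /matrixP/(_ i j) := GH s rs; rewrite !mxE.
Qed.

Lemma jet1M m n k (G : 'M[{poly F}]_(m, n)) (H : 'M_(n, k)) :
  jet1 (G *m H) = jet1 G *m mx_at 0 H + mx_at 0 G *m jet1 H.
Proof.
apply/matrixP => i j; rewrite !mxE raddf_sum horner_sum -big_split.
by apply: eq_bigr => l _; rewrite !mxE /= derivM hornerD !hornerM.
Qed.

Lemma jet1_polyC m n (A : 'M[F]_(m, n)) : jet1 (map_mx polyC A) = 0.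
Proof. by apply/matrixP => i j; rewrite !mxE derivC horner0. Qed.

Lemma jet1D m n (G H : 'M[{poly F}]_(m, n)) : jet1 (G + H) = jet1 G + jet1 H.
Proof. by apply/matrixP => i j; rewrite !mxE derivD hornerD. Qed.

Lemma jet1Z m n q (A : 'M[F]_(m, n)) :
  jet1 (q *: map_mx polyC A) = q^`().[0] *: A.
Proof.
apply/matrixP => i j; rewrite !mxE derivM derivC mulr0 addr0.
by rewrite hornerM hornerC.
Qed.

Lemma mx_atD m n s (G H : 'M[{poly F}]_(m, n)) :
  mx_at s (G + H) = mx_at s G + mx_at s H.
Proof. by apply/matrixP => i j; rewrite !mxE hornerD. Qed.

Lemma mx_atZ m n s q (G : 'M[{poly F}]_(m, n)) :
  mx_at s (q *: G) = q.[s] *: mx_at s G.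
Proof. by apply/matrixP => i j; rewrite !mxE hornerM. Qed.

Lemma mx_atB m n s (G H : 'M[{poly F}]_(m, n)) :
  mx_at s (G - H) = mx_at s G - mx_at s H.
Proof. by apply/matrixP => i j; rewrite !mxE hornerD hornerN. Qed.

(** A polynomial substitute for the one-parameter group exp(s A): it has the same velocity at s = 0,
    but is invertible only for generic s. *)
Definition mx_line n (A : 'M[F]_n) : 'M[{poly F}]_n :=
  map_mx polyC 1%:M + 'X *: map_mx polyC A.

Lemma mx_lineE n (A : 'M[F]_n) s : mx_at s (mx_line A) = 1%:M + s *: A.
Proof. by rewrite mx_atD mx_atZ !mx_at_polyC hornerX. Qed.

Lemma jet1_line n (A : 'M[F]_n) : jet1 (mx_line A) = A.
Proof. by rewrite jet1D jet1_polyC jet1Z derivX hornerC scale1r add0r. Qed.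

Lemma det_line_neq0 n (A : 'M[F]_n) : \det (mx_line A) != 0.
Proof.
apply/eqP => d0; have := det_mx_at 0 (mx_line A).
rewrite d0 horner0 mx_lineE scale0r addr0 det1 => /eqP.
by rewrite oner_eq0.
Qed.
End Jets.

(** * Differential of a polynomial representation and its Casimir element *)

Section PolynomialMaps.
Variables (F : numFieldType) (N d : nat) (P : 'M[{mpoly F[N * N]}]_d).

Definition polymap (g : 'M[F]_N) : 'M[F]_d :=
  map_mx (meval (fun l => mxvec g 0 l)) P.

Definition polymap_curve (G : 'M[{poly F}]_N) : 'M[{poly F}]_d :=
  map_mx (mmap polyC (fun l => mxvec G 0 l)) P.

Lemma polymap_curveE G s : mx_at s (polymap_curve G) = polymap (mx_at s G).
Proof.
apply/matrixP => i j; rewrite !mxE horner_mmap; apply: meval_eq => l.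
by case/mxvec_indexP: l => a b; rewrite !mxvecE mxE.
Qed.

(** The derived representation of gl_N: the gradient at the identity of each matrix coefficient,
    paired with [A]. *)
Definition differential (A : 'M[F]_N) : 'M[F]_d :=
  \matrix_(i, j) \sum_l (P i j)^`M(l).@[fun l => mxvec 1%:M 0 l] * mxvec A 0 l.

Lemma differential_is_linear : linear differential.
Proof.
move=> c A B; apply/matrixP => i j; rewrite !mxE mulr_sumr -big_split.
apply: eq_bigr => l _ /=; case/mxvec_indexP: l => a b.
by rewrite !mxvecE !mxE; ring.
Qed.

HB.instance Definition _ := GRing.isLinear.Build F 'M[F]_N 'M[F]_d _
  differential differential_is_linear.

Lemma jet1_polymap_curve G :
  mx_at 0 G = 1%:M -> jet1 (polymap_curve G) = differential (jet1 G).
Proof.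
move=> G0; apply/matrixP => i j; rewrite !mxE meval_curve_deriv.
apply: eq_bigr => l _; congr (_ * _); last first.
  by case/mxvec_indexP: l => a b; rewrite !mxvecE !mxE.
apply: meval_eq => {}l; case/mxvec_indexP: l => a b; rewrite !mxvecE.
by have /matrixP/(_ a b) := G0; rewrite !mxE.
Qed.

Lemma jet1_polymap_line A :
  jet1 (polymap_curve (mx_line A)) = differential A.
Proof.
rewrite jet1_polymap_curve ?jet1_line // mx_lineE scale0r addr0 //.
Qed.

End PolynomialMaps.

Section PolynomialRepresentation.
Variables (F : numFieldType) (N d : nat) (P : 'M[{mpoly F[N * N]}]_d).
Local Notation rho := (polymap P).
Local Notation dE i j := (differential P (delta_mx i j)).
Hypothesis rho1 : rho 1%:M = 1%:M.
Hypothesis rhoM : {in unitmx &, {morph rho : g h / g *m h}}.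

Lemma rhoV g : g \in unitmx -> rho (invmx g) *m rho g = 1%:M.
Proof. by move=> gu; rewrite -rhoM ?unitmx_inv // mulVmx. Qed.

(** Velocity at s = 0 of rho(g) rho(1 + s A) = rho(1 + s g A g^-1) rho(g). *)
Lemma differential_conj g A : g \in unitmx ->
  rho g *m differential P A = differential P (g *m A *m invmx g) *m rho g.
Proof.
move=> gu; have /(congr1 (@jet1 _ _ _)) :
    map_mx polyC (rho g) *m polymap_curve P (mx_line A)
    = polymap_curve P (mx_line (g *m A *m invmx g)) *m map_mx polyC (rho g).
  apply: (mx_at_eq_generic (det_line_neq0 A)) => s.
  rewrite -det_mx_at !mx_atM !mx_at_polyC !polymap_curveE !mx_lineE => ds.
  have lu : 1%:M + s *: A \in unitmx by rewrite unitmxE unitfE.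
  have -> : 1%:M + s *: (g *m A *m invmx g) = g *m (1%:M + s *: A) *m invmx g.
    by rewrite mulmxDr mulmxDl mulmx1 mulmxV // -scalemxAr -scalemxAl.
  by rewrite rhoM ?unitmx_mul ?gu ?lu ?unitmx_inv // rhoM // -mulmxA rhoV ?mulmx1.
rewrite !jet1M !jet1_polyC mul0mx mulmx0 add0r addr0 !mx_at_polyC.
by rewrite !jet1_polymap_line.
Qed.

Lemma unit_transvection (i j : 'I_N) s : i != j ->
  1%:M + s *: delta_mx i j \in unitmx /\
  invmx (1%:M + s *: delta_mx i j) = 1%:M - s *: delta_mx i j :> 'M[F]_N.
Proof.
move=> ij; have E : (1%:M - s *: delta_mx i j) *m (1%:M + s *: delta_mx i j)
   = 1%:M :> 'M[F]_N.
  rewrite mulmxDr mulmx1 mulmxBl mul1mx -scalemxAl -scalemxAr mul_delta_mx_0.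
    by rewrite !scaler0 subr0 subrK.
  by rewrite eq_sym.
have [_ u] := mulmx1_unit E; split=> //.
by apply: (can_inj (mulmxK u)); rewrite mulVmx.
Qed.

(** This is the coefficient of s in [differential_conj] for the transvection g = 1 + s E_ij, since g
    E_ji g^-1 = E_ji + s (E_ii - E_jj) - s^2 E_ij. *)
Lemma differential_bracket (i j : 'I_N) : i != j ->
  dE i j *m dE j i = dE j i *m dE i j + dE i i - dE j j.
Proof.
move=> ij; have /(congr1 (@jet1 _ _ _)) :
  polymap_curve P (mx_line (delta_mx i j)) *m map_mx polyC (dE j i)
  = (map_mx polyC (dE j i) + 'X *: map_mx polyC (dE i i - dE j j)
     + - 'X^2 *: map_mx polyC (dE i j))
    *m polymap_curve P (mx_line (delta_mx i j)).
  apply: (@mx_at_eq_generic _ _ _ 1) => [|s _]; first exact: oner_neq0.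
  have [u ui] := unit_transvection s ij.
  rewrite !mx_atM !mx_at_polyC !polymap_curveE !mx_lineE !mx_atD !mx_atZ.
  rewrite !mx_at_polyC hornerN hornerXn hornerX.
  rewrite differential_conj // ui; congr (_ *m _).
  rewrite -linearB /= -!linearZ_LR -!linearD /=; congr differential.
  rewrite mulmxBr mulmx1 mulmxDl mul1mx -!scalemxAl -!scalemxAr mulmxDl.
  rewrite -scalemxAl !mul_delta_mx scalerDr scalerA scalerBr -expr2 scaleNr.
  by rewrite opprD addrA; congr (_ + _); rewrite -addrA.
rewrite !jet1M !jet1D !jet1_polyC mulmx0 add0r addr0 !mx_at_polyC.
rewrite !jet1Z jet1_polymap_line polymap_curveE mx_lineE scale0r addr0 rho1.
rewrite mulmx1 !mx_atD !mx_atZ !mx_at_polyC derivN derivX derivXn expr1.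
rewrite !hornerN !hornerMn !hornerXn !hornerX hornerC expr0n mul0rn oppr0.
by rewrite !scale0r scale1r !addr0 => ->; rewrite addrC addrA.
Qed.

(* Invariance of the Casimir tensor under [g], one tensor factor at a time. *)
Lemma sum_contract (g h : 'M[F]_N) (L R : 'I_N -> 'M[F]_d) :
  g *m h = 1%:M ->
  \sum_j (\sum_b h j b *: L b) *m (\sum_c g c j *: R c) = \sum_b L b *m R b.
Proof.
move=> gh; transitivity (\sum_b \sum_c (g *m h) c b *: (L b *m R c)).
  under eq_bigr => j _ do rewrite mulmx_suml; rewrite exchange_big.
  apply: eq_bigr => b _; under eq_bigr => j _ do rewrite mulmx_sumr.
  rewrite exchange_big; apply: eq_bigr => c _ /=.
  rewrite mxE scaler_suml; apply: eq_bigr => j _.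
  by rewrite -scalemxAl -scalemxAr scalerA mulrC.
apply: eq_bigr => b _; rewrite (bigD1 b) //= big1 => [|c /negPf cb].
  by rewrite gh mxE eqxx scale1r addr0.
by rewrite gh mxE cb scale0r.
Qed.

Lemma differential_conj_delta (g h : 'M[F]_N) i j :
  differential P (g *m delta_mx i j *m h)
  = \sum_b h j b *: \sum_a g a i *: dE a b.
Proof.
rewrite [g *m _ *m _]matrix_sum_delta exchange_big linear_sum /=.
apply: eq_bigr => b _; rewrite linear_sum scaler_sumr; apply: eq_bigr => a _.
rewrite linearZ scalerA /=; congr (_ *: _); rewrite !mxE (bigD1 j) //=.
rewrite big1 => [|k /negPf kj].
  rewrite addr0 mxE (bigD1 i) //= big1 => [|k /negPf ki].
    by rewrite addr0 mxE !eqxx mulr1 mulrC.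
  by rewrite mxE ki mulr0.
by rewrite mxE big1 ?mul0r // => l _; rewrite mxE kj andbF mulr0.
Qed.

(* The central second summand makes the eigenvalue [|l + delta|^2 - |delta|^2]. *)
Definition casimir : 'M[F]_d :=
  \sum_i \sum_j dE i j *m dE j i + N.-1%:R *: \sum_i dE i i.

Lemma casimir_comm g : g \in unitmx -> rho g *m casimir = casimir *m rho g.
Proof.
move=> gu; set h := invmx g.
have gh : g *m h = 1%:M by rewrite mulmxV.
have hgT : h^T *m g^T = 1%:M by rewrite -trmx_mul gh trmx1.
have conjX i j : rho g *m dE i j = differential P (g *m delta_mx i j *m h) *m rho g.
  by rewrite differential_conj.
rewrite mulmxDr mulmxDl; congr (_ + _); last first.
  rewrite -scalemxAr -scalemxAl; congr (_ *: _).
  have -> : \sum_i dE i i = differential P 1%:M.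
    by rewrite mx1_sum_delta linear_sum.
  by rewrite differential_conj // mulmx1 mulmxV.
transitivity ((\sum_i \sum_j differential P (g *m delta_mx i j *m h)
    *m differential P (g *m delta_mx j i *m h)) *m rho g).
  rewrite mulmx_sumr mulmx_suml; apply: eq_bigr => i _.
  rewrite mulmx_sumr mulmx_suml; apply: eq_bigr => j _.
  by rewrite mulmxA conjX -mulmxA conjX mulmxA.
congr (_ *m _).
(* The sum over j is contracted with [g *m h = 1]; the sum over i is contracted afterwards with the
   transposed identity [hgT]. *)
transitivity (\sum_i \sum_b (\sum_a g a i *: dE a b) *m (\sum_d h i d *: dE b d)).
  apply: eq_bigr => i _.
  rewrite -[RHS](sum_contract _ _ gh); apply: eq_bigr => j _.
  rewrite !differential_conj_delta; congr (_ *m _).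
  under eq_bigr => b _ do rewrite scaler_sumr.
  rewrite exchange_big; apply: eq_bigr => c _ /=; rewrite scaler_sumr.
  by apply: eq_bigr => e _; rewrite !scalerA mulrC.
rewrite exchange_big [RHS]exchange_big; apply: eq_bigr => b _ /=.
rewrite -[RHS](sum_contract _ _ hgT); apply: eq_bigr => j _.
by congr (_ *m _); apply: eq_bigr => a _; rewrite mxE.
Qed.

Section HighestWeight.
Variables (l : 'I_N -> nat) (v : 'cV[F]_d).
Hypothesis v_neq0 : v != 0.
Hypothesis vP : forall b : 'M[F]_N, b \in unitmx -> is_trig_mx b^T ->
  rho b *m v = (\prod_i b i i ^+ l i) *: v.

Lemma differential_hw (i j : 'I_N) : (i <= j)%N ->
  dE i j *m v = (if i == j then (l i)%:R else 0 : F) *: v.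
Proof.
move=> ij; set q : {poly F} := if i == j then (1 + 'X) ^+ l i else 1.
have /(congr1 (@jet1 _ _ _)) :
  polymap_curve P (mx_line (delta_mx i j)) *m map_mx polyC v
  = q *: map_mx polyC v.
  apply: (mx_at_eq_generic (det_line_neq0 (delta_mx i j))) => s.
  rewrite -det_mx_at mx_atM mx_atZ !mx_at_polyC polymap_curveE mx_lineE => ds.
  rewrite vP; last 2 first.
  - by rewrite unitmxE unitfE.
  - apply/is_trig_mxP => a b ab; rewrite !mxE.
    rewrite -val_eqE gtn_eqF // add0r.
    case: andP => [[/eqP ei /eqP ej]|]; last by rewrite mulr0.
    by move: ab; rewrite ei ej ltnNge ij.
  congr (_ *: _); rewrite /q; have [->|nij] := eqVneq i j; last first.
    rewrite hornerC big1 // => k _; rewrite !mxE eqxx.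
    case: andP => [[/eqP ei /eqP ej]|]; last by rewrite mulr0 addr0 expr1n.
    by rewrite -ei -ej eqxx in nij.
  rewrite (bigD1 j) //= big1 ?mulr1 => [|k /negPf kj]; last first.
    by rewrite !mxE eqxx kj mulr0 addr0 expr1n.
  by rewrite !mxE !eqxx mulr1 horner_exp hornerD hornerX hornerC.
rewrite jet1M jet1_polyC mulmx0 addr0 jet1Z mx_at_polyC jet1_polymap_line => ->.
congr (_ *: _); rewrite /q; case: eqP => _; last by rewrite derivC horner0.
rewrite deriv_exp derivD derivX derivC add0r mul1r hornerMn horner_exp.
by rewrite hornerD hornerX hornerC addr0 expr1n.
Qed.

Definition casimir_eigenvalue : F :=
  \sum_i ((l i + (N.-1 - i))%:R ^+ 2 - (N.-1 - i)%:R ^+ 2).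

(** For i > j the factor E_ji kills [v]; for i < j the bracket relation turns E_ij E_ji into E_ii -
    E_jj on [v], because E_ij kills it. *)
Lemma casimir_hw : casimir *m v = casimir_eigenvalue *: v.
Proof.
have entry (i j : 'I_N) : dE i j *m dE j i *m v =
    (if i == j then (l i)%:R ^+ 2
     else if (i < j)%N then (l i)%:R - (l j)%:R else 0 : F) *: v.
  have [->|ij] := eqVneq i j.
    by rewrite -mulmxA differential_hw // eqxx -scalemxAr differential_hw //
       eqxx scalerA expr2.
  case: ltnP => ji; last first.
    have {}ij : (j == i) = false by rewrite eq_sym (negPf ij).
    by rewrite -mulmxA differential_hw // ij (scale0r v) mulmx0.
  rewrite differential_bracket // 2!mulmxDl mulNmx -mulmxA.
  rewrite !differential_hw ?(ltnW ji) // (negPf ij) !eqxx (scale0r v) mulmx0 add0r.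
  by rewrite scalerBl.
rewrite mulmxDl mulmx_suml -scalemxAl mulmx_suml.
under eq_bigr => i _.
  rewrite mulmx_suml; under eq_bigr => j _ do rewrite entry.
  rewrite -scaler_suml; over.
under [X in _ + _ *: X]eq_bigr => i _ do rewrite differential_hw // eqxx.
rewrite -!scaler_suml scalerA -scalerDl; congr (_ *: _).
(* The cross term 2 (N - 1 - i) l_i is split by origin: N - 1 - i indices above i, minus i indices
   below i, plus N - 1 from the central summand. *)
transitivity (\sum_i ((l i)%:R ^+ 2 + (N.-1 - i)%:R * (l i)%:R
    - i%:R * (l i)%:R + N.-1%:R * (l i)%:R : F)); last first.
  apply: eq_bigr => i _; rewrite natrD natrB; first by ring.
  by rewrite -ltnS prednK // (leq_trans _ (ltn_ord i)).
rewrite mulr_sumr !big_split /= sumrN; congr (_ + _).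
transitivity (\sum_(i < N) \sum_(j < N) ((i == j)%:R * (l i)%:R ^+ 2
    + (i < j)%:R * (l i)%:R - (i < j)%:R * (l j)%:R) : F).
  apply: eq_bigr => i _; apply: eq_bigr => j _.
  have [->|ij] := eqVneq i j; first by rewrite ltnn /=; ring.
  by case: ltnP => _ /=; ring.
under [LHS]eq_bigr => i _ do rewrite sumrB big_split /=.
rewrite sumrB big_split /=; congr (_ + _ - _).
- apply: eq_bigr => i _; rewrite (bigD1 i) //= eqxx mul1r big1 ?addr0 // => j.
  by rewrite eq_sym => /negPf->; rewrite mul0r.
- apply: eq_bigr => i _; rewrite -mulr_suml; congr (_ * _).
  by rewrite -natr_sum sum_ltn_r -subn1 subnAC subn1 -subnS.
rewrite exchange_big; apply: eq_bigr => j _ /=; rewrite -mulr_suml; congr (_ * _).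
by rewrite -natr_sum sum_ltn_l (minn_idPr (ltnW (ltn_ord j))).
Qed.

Hypothesis irr : forall W : {vspace 'cV[F]_d},
  (forall g w, g \in unitmx -> w \in W -> rho g *m w \in W) ->
  W = 0%VS \/ W = fullv.

(** Schur's lemma without algebraic closure: the eigenspace for the eigenvalue already found
    contains [v] and is stable, hence is the whole space. *)
Lemma casimir_scalar : casimir = casimir_eigenvalue%:M.
Proof.
set c := casimir_eigenvalue.
pose f : 'cV[F]_d -> 'cV[F]_d := mulmx (casimir - c%:M).
have fE w : (w \in lker (linfun f)) = (casimir *m w == c *: w).
  by rewrite memv_ker lfunE /= /f mulmxBl mul_scalar_mx subr_eq0.
have [|W0|WT] := irr (W := lker (linfun f)).
- move=> g w gu; rewrite !fE => /eqP cw.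
  by rewrite mulmxA -casimir_comm // -mulmxA cw scalemxAr.
- have : v \in lker (linfun f) by rewrite fE casimir_hw.
  by rewrite W0 memv0 (negPf v_neq0).
apply/matrixP => i j; have : delta_mx j 0 \in lker (linfun f) by rewrite WT memvf.
rewrite fE -colE => /eqP/colP/(_ i); rewrite !mxE => ->.
by rewrite andbT; case: eqP; rewrite ?mulr1 ?mulr0.
Qed.

End HighestWeight.
End PolynomialRepresentation.

(** * Alternants and the Laplacian of the torus *)

Lemma mpoly_eq_generic (F : numFieldType) n (r p q : {mpoly F[n]}) :
  r != 0 -> (forall v, r.@[v] != 0 -> p.@[v] = q.@[v]) -> p = q.
Proof.
move=> rn0 pq; apply/eqP; rewrite -subr_eq0.
have : (p - q) * r = 0.
  apply: mpoly_eval_eq0 => v; rewrite mevalM mevalB.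
  have [->|/pq ->] := eqVneq r.@[v] 0; first by rewrite mulr0.
  by rewrite subrr mul0r.
by move/eqP; rewrite mulf_eq0 (negPf rn0) orbF.
Qed.

Section Alternants.
Variables (F : numFieldType) (N : nat).
Implicit Types (p q : {mpoly F[N]}) (m : 'X_{1..N}) (l : 'I_N -> nat).

(** The invariant vector field t_i d/dt_i of the torus, diagonal on monomials. *)
Definition theta i p : {mpoly F[N]} := 'X_i * p^`M(i).

Lemma mcoeff_theta i p m : (theta i p)@_m = (m i)%:R * p@_m.
Proof.
elim/mpolyind: p m => [|c m' q _ _ IH] m.
  by rewrite /theta mderiv0 mulr0 !mcoeff0 mulr0.
rewrite /theta mderivD mulrDr 2!mcoeffD mulrDr; congr (_ + _); last exact: IH.
rewrite mderivZ mderivX -scalerAr -scalerAr !mcoeffZ mcoeffX.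
have [mi|mi] := eqVneq (m' i) 0%N.
  rewrite mi mul0r mulr0; case: eqP => [<-|_]; last by rewrite !mulr0.
  by rewrite mi mul0r.
rewrite -mpolyXD addmC submK ?lep1mP // mcoeffX.
by case: eqP => [<-|_]; rewrite ?mulr0 // !mulr1 mulrC.
Qed.

Lemma thetaM i p q : theta i (p * q) = theta i p * q + p * theta i q.
Proof. by rewrite /theta mderivM; ring. Qed.

Lemma thetaD i p q : theta i (p + q) = theta i p + theta i q.
Proof. by rewrite /theta mderivD mulrDr. Qed.

Definition laplacian p : {mpoly F[N]} := \sum_i theta i (theta i p).

Lemma mcoeff_laplacian p m :
  (laplacian p)@_m = (\sum_i (m i) ^ 2)%:R * p@_m.
Proof.
rewrite /laplacian raddf_sum natr_sum mulr_suml; apply: eq_bigr => i _ /=.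
by rewrite !mcoeff_theta mulrA -natrM.
Qed.

Definition alternant l : {mpoly F[N]} :=
  \det (\matrix_(i, j) 'X_i ^+ l j).

Lemma alternantE l :
  alternant l = \sum_(s : 'S_N) (-1) ^+ s *: 'X_[[multinom l (s i) | i < N]].
Proof.
apply: eq_bigr => s _; rewrite mpolyXE_id -[RHS]mul_mpolyC.
rewrite rmorphXn rmorphN1; congr (_ * _).
by apply: eq_bigr => i _; rewrite mxE mnmE.
Qed.

Lemma mcoeff_alternant_neq0 l m :
  (alternant l)@_m != 0 -> exists s : 'S_N, m = [multinom l (s i) | i < N].
Proof.
rewrite alternantE raddf_sum /= => nz.
have /existsP[s /eqP ->] : [exists s : 'S_N, m == [multinom l (s i) | i < N]].
  apply: contraNT nz => /existsPn ne; rewrite big1 // => s _.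
  by rewrite mcoeffZ mcoeffX eq_sym (negPf (ne s)) mulr0.
by exists s.
Qed.

Lemma mcoeff_alternant l : injective l ->
  (alternant l)@_[multinom l i | i < N] = 1.
Proof.
move=> l_inj; rewrite alternantE raddf_sum /= (bigD1 1%g) //= big1 => [|s s1].
  rewrite odd_perm1 expr0 scale1r addr0 mcoeffX.
  by case: eqP => // /mnmP []; move=> i; rewrite !mnmE perm1.
rewrite mcoeffZ mcoeffX; case: eqP => [/mnmP E|_]; last by rewrite mulr0.
case/eqP: s1; apply/permP => i; rewrite perm1; apply: l_inj.
by have := E i; rewrite !mnmE.
Qed.

Lemma alternant_eval l (t : 'I_N -> F) :
  (alternant l).@[t] = \det (\matrix_(i, j) t i ^+ l j).
Proof.
rewrite -[LHS](det_map_mx (meval t)); congr (\det _); apply/matrixP => i j.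
by rewrite !mxE rmorphXn /= mevalXU.
Qed.

Definition stair (j : 'I_N) : nat := N.-1 - j.

(** Vandermonde determinant with its columns reversed and every factor negated; [c] collects the two
    signs. In each factor the variable of smaller index comes first, which is the leading one for a
    decreasing functional. *)
Lemma stair_alternant : exists2 c : F, c ^+ 2 = 1 &
  alternant stair = c *: \prod_(p : 'I_N * 'I_N | (p.1 < p.2)%N) ('X_(p.1) - 'X_(p.2)).
Proof.
have : exists2 c : F, c ^+ 2 = 1 & alternant stair =
    c *: \prod_(p : 'I_N * 'I_N | (p.1 < p.2)%N) ('X_(p.2) - 'X_(p.1)).
  pose rp := perm (@rev_ord_inj N).
  exists ((-1) ^+ rp); first by rewrite sqrr_sign.
  rewrite -(pair_big_dep xpredT (fun i j : 'I_N => i < j)%N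
     (fun i j => 'X_j - 'X_i)) /=.
  have := det_Vandermonde (\row_(i < N) ('X_i : {mpoly F[N]})).
  under [RHS]eq_bigr => i _ do under eq_bigr => j _ do rewrite !mxE.
  move=> <-; rewrite -mul_mpolyC rmorph_sign -det_perm -det_mulmx -det_tr.
  congr (\det _); rewrite -row_permE; apply/matrixP => i j; rewrite !mxE.
  by congr (_ ^+ _); rewrite permE /= /stair subnS -subn1 subnAC subn1.
case=> c c2 E; exists (c * (-1) ^+ #|[pred p : 'I_N * 'I_N | (p.1 < p.2)%N]|).
  by rewrite exprMn c2 sqrr_sign mulr1.
rewrite E -scalerA; congr (_ *: _).
rewrite -[in RHS]mul_mpolyC rmorph_sign -prodr_const -big_split /=.
by apply: eq_bigr => p _; rewrite mulN1r opprB.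
Qed.

Lemma mderiv_prod_eval (I : Type) (r : seq I) (Q : pred I)
    (f : I -> {mpoly F[N]}) i (t : 'I_N -> F) :
  (forall k, Q k -> (f k).@[t] != 0) ->
  (\prod_(k <- r | Q k) f k)^`M(i).@[t]
  = (\prod_(k <- r | Q k) f k).@[t]
    * \sum_(k <- r | Q k) (f k)^`M(i).@[t] / (f k).@[t].
Proof.
move=> nz; elim: r => [|k r IH]; first by rewrite !big_nil -mpolyC1 mderivC meval0 mulr0.
rewrite !big_cons; case: ifP => Qk //.
rewrite mderivM mevalD !mevalM IH mulrDr; congr (_ + _); last by rewrite mulrA.
by field; rewrite nz.
Qed.

(** Logarithmic derivative of the Vandermonde product, in which the unknown sign cancels. These
    ratios are also the coefficients of the first-order part of the Casimir operator on the
    torus. *)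
Lemma theta_stair i (t : 'I_N -> F) : injective t ->
  (theta i (alternant stair)).@[t]
  = (alternant stair).@[t] * \sum_(j | j != i) t i / (t i - t j).
Proof.
move=> t_inj; have [c _ ->] := stair_alternant.
set V := \prod_(p | _) _.
rewrite /theta mderivZ mevalM !mevalZ mevalXU mderiv_prod_eval; last first.
  move=> [a b] /= ab; rewrite mevalB !mevalXU subr_eq0; apply/eqP => /t_inj E.
  by rewrite E ltnn in ab.
rewrite -/V mulrCA -mulrA; congr (_ * _); rewrite mulrCA; congr (_ * _).
rewrite mulr_sumr.
transitivity (\sum_(p : 'I_N * 'I_N | (p.1 < p.2)%N)
   ((p.1 == i)%:R * (t i / (t i - t p.2))
     + (p.2 == i)%:R * (t i / (t i - t p.1)))).
  apply: eq_bigr => -[a b] /= ab; rewrite mevalB !mevalXU mderivB !mderivX.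
  have UE j : (U_(j)%MM i)%:R *: 'X_[U_(j) - U_(i)] = (j == i)%:R :> {mpoly F[N]}.
    rewrite mnm1E; have [->|_] := eqVneq j i; last by rewrite scale0r.
    by rewrite -{1}[U_(i)%MM]add0m addmK mpolyX0 scale1r.
  rewrite !UE mevalB !rmorph_nat.
  have [ai|_] := eqVneq a i; have [bi|_] := eqVneq b i.
  - by rewrite ai bi ltnn in ab.
  - by rewrite ai subr0 mul0r addr0 !mul1r.
  - by rewrite bi mul0r !add0r mul1r mulN1r -invrN opprB.
  - by rewrite subrr !mul0r mulr0 addr0.
rewrite big_split /= [RHS](bigID (fun j : 'I_N => i < j)%N) /=; congr (_ + _).
  rewrite -(pair_big_dep xpredT (fun a b : 'I_N => a < b)%N
     (fun a b => (a == i)%:R * (t i / (t i - t b)))) /=.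
  rewrite (bigD1 i) //= [X in _ + X]big1 => [|a /negPf ->]; last first.
    by rewrite big1 // => b _; rewrite mul0r.
  rewrite addr0; apply: eq_big => [j|j _]; last by rewrite eqxx mul1r.
  by case: ltnP => ij; rewrite ?andbF // -val_eqE gtn_eqF.
rewrite -(pair_big_dep xpredT (fun a b : 'I_N => a < b)%N
     (fun a b => (b == i)%:R * (t i / (t i - t a)))) /= [RHS]big_mkcond.
apply: eq_bigr => a _; rewrite -leqNgt -val_eqE -ltn_neqAle.
case: ifP => ai; last first.
  rewrite big1 // => b ab; case: eqP => [bi|]; last by rewrite mul0r.
  by rewrite -bi ab in ai.
rewrite (bigD1 i) //= eqxx mul1r big1 ?addr0 // => b /andP[_ /negPf ->].
by rewrite mul0r.
Qed.
End Alternants.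

(** * The character on the torus *)

Section Torus.
Variables (F : numFieldType) (N d : nat) (P : 'M[{mpoly F[N * N]}]_d).
Local Notation rho := (polymap P).
Local Notation dE i j := (differential P (delta_mx i j)).
Local Notation dg t := (diag_mx (\row_i t i)).
Hypothesis rho1 : rho 1%:M = 1%:M.
Hypothesis rhoM : {in unitmx &, {morph rho : g h / g *m h}}.

Definition torus_mx : 'M[{mpoly F[N]}]_d :=
  map_mx (comp_mpoly [tuple mxvec (diag_mx (\row_i 'X_i)) 0 l | l < N * N]) P.

Definition torus_char : {mpoly F[N]} := \tr torus_mx.

Lemma torus_mxE t : map_mx (meval t) torus_mx = rho (dg t).
Proof.
apply/matrixP => i j; rewrite !mxE comp_mpoly_meval; apply: meval_eq => l.
rewrite tnth_mktuple; case/mxvec_indexP: l => a b; rewrite !mxvecE !mxE.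
by case: eqP => _; rewrite ?mulr1n ?mulr0n ?mevalXU ?meval0.
Qed.

Lemma torus_charE t : torus_char.@[t] = \tr (rho (dg t)).
Proof. by rewrite -torus_mxE -(trace_map_mx (meval t)). Qed.

Lemma diag_unit (t : 'I_N -> F) :
  (forall i, t i != 0) -> dg t \in unitmx.
Proof.
move=> t0; rewrite unitmxE unitfE det_diag; apply/prodf_neq0 => i _.
by rewrite mxE.
Qed.

Lemma prodX_eval (t : 'I_N -> F) : (\prod_i 'X_i : {mpoly F[N]}).@[t] = \prod_i t i.
Proof. by rewrite rmorph_prod; apply: eq_bigr => i _ /=; rewrite mevalXU. Qed.

Lemma mpoly_eq_torus (r p q : {mpoly F[N]}) : r != 0 ->
  (forall t, (forall i, t i != 0) -> r.@[t] != 0 -> p.@[t] = q.@[t]) -> p = q.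
Proof.
move=> rn0 pq; apply: (@mpoly_eq_generic _ _ (r * \prod_i 'X_i)).
  rewrite mulf_neq0 //; apply/prodf_neq0 => i _.
  by rewrite -msize_poly_eq0 mmeasureX.
move=> v; rewrite mevalM prodX_eval mulf_eq0 negb_or => /andP[rv].
by move=> /prodf_neq0 v0; apply: pq => // i; apply: v0.
Qed.

(** Velocity at s = 0 of rho(t) rho(1 + s E_ii), which is rho at the point where t_i is replaced by
    t_i (1 + s). *)
Lemma torus_mul_differential i :
  torus_mx *m map_mx (@mpolyC N F) (dE i i) = map_mx (theta i) torus_mx.
Proof.
suff E t : (forall i, t i != 0) ->
    rho (dg t) *m dE i i = map_mx (fun p => (theta i p).@[t]) torus_mx.
  apply/matrixP => a b; apply: (@mpoly_eq_torus 1); first exact: oner_neq0.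
  move=> t t0 _; have /matrixP /(_ a b) := E t t0.
  rewrite [X in _ = X -> _]mxE [(map_mx (theta i) torus_mx) a b]mxE => <-.
  rewrite -torus_mxE !mxE rmorph_sum; apply: eq_bigr => k _ /=.
  by rewrite mevalM !mxE mevalC.
(* [h] is the curve of torus points obtained from [t] by multiplying the coordinate t_i by 1 + s. *)
move=> t0; pose h j : {poly F} := (t j)%:P + (t i *+ (i == j)) *: 'X.
have /(congr1 (@jet1 _ _ _)) : map_mx polyC (rho (dg t)) *m
    polymap_curve P (mx_line (delta_mx i i)) = map_mx (mmap polyC h) torus_mx.
  apply: (mx_at_eq_generic (det_line_neq0 (delta_mx i i))) => s.
  rewrite -det_mx_at mx_atM !mx_at_polyC polymap_curveE mx_lineE => ds.
  rewrite -rhoM ?diag_unit // ?unitmxE ?unitfE //.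
  have -> : mx_at s (map_mx (mmap polyC h) torus_mx) = rho (dg (fun j => (h j).[s])).
    by rewrite -torus_mxE; apply/matrixP => a b; rewrite !mxE horner_mmap.
  congr polymap; apply/matrixP => a b.
  rewrite mul_diag_mx !mxE /h hornerD hornerC hornerZ hornerX.
  have [->|ab] := eqVneq a b; last first.
    rewrite !mulr0n add0r; case: andP => [[/eqP ea /eqP eb]|]; last by rewrite !mulr0.
    by rewrite ea eb eqxx in ab.
  by rewrite !mulr1n andbb (eq_sym i); case: eqP => [->|_] /=; rewrite ?mulr0n; ring.
rewrite jet1M jet1_polyC mul0mx add0r mx_at_polyC jet1_polymap_line => ->.
apply/matrixP => a b; rewrite !mxE meval_curve_deriv /theta.
rewrite (bigD1 i) //= big1 => [|j /negPf ji].
  rewrite addr0 mevalM mevalXU mulrC /h derivD derivC derivZ derivX eqxx add0r.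
  rewrite hornerZ hornerC mulr1 mulr1n; congr (_ * _); apply: meval_eq => j.
  by rewrite hornerD hornerZ hornerC hornerX mulr0 addr0.
rewrite /h derivD derivC derivZ derivX eq_sym ji mulr0n scale0r addr0 horner0.
by rewrite mulr0.
Qed.

Lemma trace_differential i t :
  (forall i, t i != 0) -> \tr (rho (dg t) *m dE i i) = (theta i torus_char).@[t].
Proof.
move=> t0; have /(congr1 (fun M => (\tr M).@[t])) := torus_mul_differential i.
have -> : \tr (map_mx (theta i) torus_mx) = theta i torus_char.
  rewrite /torus_char /mxtrace /theta raddf_sum mulr_sumr.
  by apply: eq_bigr => k _; rewrite mxE.
move=> <-; rewrite -torus_mxE -(trace_map_mx (meval t)) map_mxM /=.
by congr (\tr (_ *m _)); apply/matrixP => a b; rewrite !mxE mevalC.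
Qed.

Lemma trace_differential2 i t : (forall i, t i != 0) ->
  \tr (rho (dg t) *m (dE i i *m dE i i)) = (theta i (theta i torus_char)).@[t].
Proof.
move=> t0; set C := map_mx (@mpolyC N F) (dE i i).
have thC (T : 'M[{mpoly F[N]}]_d) :
    map_mx (theta i) T *m C = map_mx (theta i) (T *m C).
  apply/matrixP => a b; rewrite !mxE /theta raddf_sum mulr_sumr.
  apply: eq_bigr => k _ /=.
  by rewrite !mxE mderivM mderivC mulr0 addr0 mulrA.
have E : torus_mx *m C *m C = map_mx (theta i) (map_mx (theta i) torus_mx).
  by rewrite torus_mul_differential thC torus_mul_differential.
have trth (M : 'M[{mpoly F[N]}]_d) : \tr (map_mx (theta i) M) = theta i (\tr M).
  rewrite /mxtrace /theta raddf_sum mulr_sumr.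
  by apply: eq_bigr => k _; rewrite mxE.
have /(congr1 (fun M => (\tr M).@[t])) := E; rewrite !trth => <-.
rewrite -torus_mxE -(trace_map_mx (meval t)) !map_mxM /= mulmxA.
by congr (\tr (_ *m _ *m _)); apply/matrixP => a b; rewrite !mxE mevalC.
Qed.

(* Moving [rho t] past [dE i j] multiplies by [t i / t j]; cyclicity of the trace
   then turns the bracket relation into an equation for this trace. *)
Lemma trace_root i j t : i != j -> (forall i, t i != 0) -> t i != t j ->
  \tr (rho (dg t) *m (dE i j *m dE j i))
  = t i / (t i - t j) * ((theta i torus_char).@[t] - (theta j torus_char).@[t]).
Proof.
move=> ij t0 tij; have tu := diag_unit t0.
have comm : rho (dg t) *m dE i j = (t i / t j) *: (dE i j *m rho (dg t)).
  rewrite (differential_conj rho1 rhoM) // scalemxAl -linearZ_LR /=.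
  congr (differential P _ *m _).
  apply: (can_inj (mulmxK tu)); rewrite mulmxKV // mul_diag_mx.
  apply/matrixP => a b; rewrite mul_mx_diag !mxE.
  case: andP => [[/eqP -> /eqP ->]|]; last by rewrite !mulr0 mul0r.
  by field; rewrite t0.
set tau := \tr _.
have E : tau = t i / t j * (tau - ((theta i torus_char).@[t] - (theta j torus_char).@[t])).
  rewrite {1}/tau mulmxA comm -scalemxAl mxtraceZ -mulmxA mxtrace_mulC -mulmxA.
  congr (_ * _); rewrite /tau (differential_bracket rho1 rhoM) // -!trace_differential //.
  by rewrite mulmxBr mulmxDr linearB linearD /=; ring.
have tn : t i - t j != 0 by rewrite subr_eq0.
apply: (mulfI tn); set h := _.@[t] - _ in E *.
transitivity (t j * (t i / t j * tau - tau)); first by field; rewrite t0.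
rewrite {2}E; field; rewrite t0 tn //.
Qed.

(** * Radial part of the Casimir element *)

Section Radial.
Variable c : F.
Hypothesis casimirE : casimir P = c%:M.

(** The traces of E_ij E_ji for i != j are given by [trace_root]. Exchanging i and j in the terms
    with u_j doubles the terms with u_i and leaves -(N - 1) times the sum of the u_i, which the
    central summand of [casimir] cancels. *)
Lemma torus_char_radial t : (forall i, t i != 0) -> injective t ->
  (laplacian torus_char).@[t] + 2 * \sum_i \sum_(j | j != i)
     t i / (t i - t j) * (theta i torus_char).@[t] = c * torus_char.@[t].
Proof.
move=> t0 t_inj; set u := fun i => (theta i torus_char).@[t].
have : \tr (rho (dg t) *m casimir P) = c * torus_char.@[t].
  by rewrite casimirE mul_mx_scalar linearZ torus_charE.
move=> <-.
have -> : (laplacian torus_char).@[t]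
    = \sum_i \tr (rho (dg t) *m (dE i i *m dE i i)).
  rewrite /laplacian rmorph_sum; apply: eq_bigr => i _ /=.
  by rewrite trace_differential2.
have -> : \tr (rho (dg t) *m casimir P) =
   \sum_i \sum_j \tr (rho (dg t) *m (dE i j *m dE j i))
   + N.-1%:R * \sum_i u i.
  rewrite /casimir mulmxDr linearD -scalemxAr linearZ !mulmx_sumr !linear_sum /=.
  congr (_ + _ * _); apply: eq_bigr => i _; last by rewrite trace_differential.
  by rewrite mulmx_sumr linear_sum.
have -> : \sum_i \sum_j \tr (rho (dg t) *m (dE i j *m dE j i)) =
    \sum_i \tr (rho (dg t) *m (dE i i *m dE i i))
    + \sum_i \sum_(j | j != i) t i / (t i - t j) * (u i - u j).
  rewrite -big_split; apply: eq_bigr => i _; rewrite (bigD1 i) //=.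
  congr (_ + _); apply: eq_bigr => j ji; rewrite trace_root 1?eq_sym //.
  by apply: contra_neq ji => /t_inj.
rewrite -addrA; congr (_ + _).
(* This rests on t_j / (t_j - t_i) = 1 - t_i / (t_i - t_j). *)
have swap : \sum_i \sum_(j | j != i) t i / (t i - t j) * u j
    = \sum_i \sum_(j | j != i) (1 - t i / (t i - t j)) * u i.
  rewrite (exchange_big_dep xpredT) //=; apply: eq_bigr => i _.
  apply: eq_big => [j|j ij]; first by rewrite eq_sym.
  have tij : t i - t j != 0 by rewrite subr_eq0; apply: contra_neq ij => /t_inj.
  have tji : t j - t i != 0 by rewrite -opprB oppr_eq0.
  by congr (_ * _); field; rewrite tij tji.
have split_diff : \sum_i \sum_(j | j != i) t i / (t i - t j) * (u i - u j)
    = \sum_i \sum_(j | j != i) t i / (t i - t j) * u i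
      - \sum_i \sum_(j | j != i) t i / (t i - t j) * u j.
  rewrite -sumrB; apply: eq_bigr => i _; rewrite -sumrB.
  by apply: eq_bigr => j _; rewrite mulrBr.
rewrite split_diff swap -!sumrB mulr_sumr [X in _ + X]mulr_sumr -big_split.
apply: eq_bigr => i _ /=.
have -> : N.-1%:R * u i = \sum_(j | j != i) u i.
  by rewrite sumr_const mulr_natl cardC1 card_ord.
rewrite mulr_sumr -sumrB -big_split; apply: eq_bigr => j _ /=; ring.
Qed.
End Radial.
End Torus.

(** * Highest weight theory *)

Section Domination.
Variables (F : numFieldType) (N : nat) (a : 'I_N -> nat).
Implicit Types (p q : {mpoly F[N]}) (m : 'X_{1..N}).

Definition wt m : nat := \sum_i m i * a i.

Lemma wtD m1 m2 : wt (m1 + m2) = (wt m1 + wt m2)%N.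
Proof. by rewrite /wt -big_split; apply: eq_bigr => i _; rewrite mnmDE mulnDl. Qed.

Lemma wt1 i : wt U_(i) = a i.
Proof.
rewrite /wt (bigD1 i) //= mnm1E eqxx mul1n big1 ?addn0 // => j /negPf ji.
by rewrite mnm1E eq_sym ji mul0n.
Qed.

(** A single linear functional replaces the dominance order: exponents of [p] other than [m0] have
    strictly smaller weight. The coefficient at [m0] itself may vanish. *)
Definition dominated m0 p :=
  forall m, p@_m != 0 -> m = m0 \/ (wt m < wt m0)%N.

Lemma dominatedP m0 p : dominated m0 p ->
  exists2 r, p = p@_m0 *: 'X_[m0] + r & forall m, r@_m != 0 -> (wt m < wt m0)%N.
Proof.
move=> dp; exists (p - p@_m0 *: 'X_[m0]); first by rewrite addrC subrK.
move=> m; rewrite mcoeffB mcoeffZ mcoeffX; have [->|ne] := eqVneq m0 m.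
  by rewrite mulr1 subrr eqxx.
by rewrite mulr0 subr0 => /dp[E|//]; rewrite E eqxx in ne.
Qed.

Lemma mcoeffM_neq0 p q m : (p * q)@_m != 0 ->
  exists m1 m2, [/\ m = (m1 + m2)%MM, p@_m1 != 0 & q@_m2 != 0].
Proof.
rewrite -mcoeff_msupp => /msuppM_le /allpairsP[[m1 m2] /= [h1 h2 ->]].
by exists m1, m2; rewrite -!mcoeff_msupp.
Qed.

(** Since the functional is additive, [m1 + m2] arises from a pair of exponents of [p] and [q] in
    one way only. *)
Lemma dominatedM m1 m2 p q : dominated m1 p -> dominated m2 q ->
  dominated (m1 + m2) (p * q) /\ (p * q)@_(m1 + m2) = p@_m1 * q@_m2.
Proof.
move=> dp dq; split.
  move=> m /mcoeffM_neq0[n1 [n2 [-> /dp h1 /dq h2]]]; rewrite !wtD.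
  by case: h1 => [->|h1]; case: h2 => [->|h2]; [by left | right | right | right]; lia.
have [r pE rP] := dominatedP dp.
rewrite {1}pE mulrDl mcoeffD -scalerAl mcoeffZ ['X_[m1] * q]mulrC mcoeffMX.
rewrite -[RHS]addr0; congr (_ + _).
apply/eqP; apply: contraT => /mcoeffM_neq0[n1 [n2 [E /rP h1 /dq h2]]].
move/(congr1 wt): E; rewrite !wtD; case: h2 => [->|h2]; lia.
Qed.

Lemma dominated_prod (I : Type) (r : seq I) (Q : pred I)
    (f : I -> {mpoly F[N]}) (m : I -> 'X_{1..N}) :
  (forall k, Q k -> dominated (m k) (f k)) ->
  dominated (\sum_(k <- r | Q k) m k) (\prod_(k <- r | Q k) f k).
Proof.
move=> df; elim: r => [|k r IH]; first rewrite !big_nil => m'.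
  by rewrite mcoeff1 pnatr_eq0 eqb0 negbK => /eqP; left.
by rewrite !big_cons; case: ifP => // /df dk; case: (dominatedM dk IH).
Qed.

Hypothesis a_dec : forall i j : 'I_N, (i < j)%N -> (a j < a i)%N.

(** In each factor X_i - X_j with i < j the monomial X_i dominates, as [a] decreases; the product of
    these X_i is X^stair. *)
Lemma dominated_stair :
  dominated [multinom stair i | i < N] (alternant F (@stair N)).
Proof.
have [c _ ->] := stair_alternant F N.
suff E : [multinom stair i | i < N]
    = (\sum_(p : 'I_N * 'I_N | (p.1 < p.2)%N) U_(p.1))%MM.
  have dp : dominated [multinom stair i | i < N]
      (\prod_(p : 'I_N * 'I_N | (p.1 < p.2)%N) ('X_(p.1) - 'X_(p.2) : {mpoly F[N]})).
    rewrite E; apply: dominated_prod => -[i j] /= ij m.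
    rewrite mcoeffB !mcoeffX; have [<-|_] := eqVneq U_(i)%MM m; first by left.
    have [<- _|_] := eqVneq U_(j)%MM m; last by rewrite subrr eqxx.
    by right; rewrite !wt1 a_dec.
  by move=> m; rewrite mcoeffZ mulf_eq0 negb_or => /andP[_ /dp].
apply/mnmP => i; rewrite mnmE mnm_sumE.
rewrite -(pair_big_dep xpredT (fun a b : 'I_N => a < b)%N (fun a b => U_(a)%MM i)) /=.
rewrite (bigD1 i) //= [X in (_ + X)%N]big1 => [|j /negPf ji]; last first.
  by rewrite big1 // => k _; rewrite mnm1E ji.
rewrite addn0 /stair -subn1 subnAC subn1 -subnS -sum_ltn_r [RHS]big_mkcond /=.
by apply: eq_bigr => j _; rewrite mnm1E eqxx; case: ltnP.
Qed.
End Domination.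

(** [S] is an arbitrary proposition (later, membership in the orbit of [v]), so a spanning family is
    grown by excluded middle, one vector outside the current span at a time; the dimension bounds
    the number of steps. *)
Lemma span_of_pred (F : fieldType) (V : vectType F) (S : V -> Prop) :
  exists2 X : seq V, (forall x, x \in X -> S x) & forall x, S x -> x \in <<X>>%VS.
Proof.
suff [//|[X _]] : (exists2 X : seq V, (forall x, x \in X -> S x)
    & forall x, S x -> x \in <<X>>%VS) \/
  exists2 X : seq V, (forall x, x \in X -> S x) & ((\dim {:V}).+1 <= \dim <<X>>)%N.
  by rewrite ltnNge dimvS ?subvf.
elim: (\dim {:V}).+1 => [|k [|[X XS kX]]]; [by right; exists [::] | by left |].
have [XC|/existsNP[x /not_implyP[Sx xX]]] :=
  EM (forall x, S x -> x \in <<X>>%VS); first by left; exists X.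
right; exists (x :: X) => [y|]; first by rewrite inE => /predU1P[->|/XS].
apply: (leq_ltn_trans kX); rewrite span_cons ltnNge; apply/negP => le.
have sub : (<<X>> <= <[x]> + <<X>>)%VS by rewrite addvSr.
have /eqP E : <<X>>%VS == (<[x]> + <<X>>)%VS by rewrite eqEdim sub.
by apply: xX; rewrite E memvE addvSl.
Qed.

(** Gaussian elimination along a curve through the identity. The pivots equal 1 at s = 0, so they
    are nonzero polynomials, and [q] is their product. *)
Lemma lu_generic (F : numFieldType) n (G : 'M[{poly F}]_n) : mx_at 0 G = 1%:M ->
  exists2 q : {poly F}, q != 0 & forall s, q.[s] != 0 ->
    exists L U : 'M[F]_n,
      [/\ is_trig_mx L, forall i, L i i = 1, is_trig_mx U^T & mx_at s G = L *m U].
Proof.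
elim: n G => [|n IH] G G0.
  exists 1 => [|s _]; first exact: oner_neq0.
  exists 1%:M, 1%:M; split; rewrite ?trmx1 ?scalar_mx_is_trig //; first by case.
  by apply/matrixP => -[].
move: G G0; rewrite -[n.+1]/(1 + n)%N => G G0.
pose a := G 0 0; pose b := ursubmx G; pose c := dlsubmx G; pose D := drsubmx G.
have GE : G = block_mx a%:M b c D.
  rewrite -[LHS]submxK; congr block_mx; apply/matrixP => i j.
  by rewrite !ord1 !mxE eqxx mulr1n; congr (G _ _); apply/val_inj.
have at_block s : mx_at s G = block_mx (a.[s])%:M (mx_at s b) (mx_at s c) (mx_at s D).
  rewrite GE /mx_at map_block_mx; congr block_mx; apply/matrixP => i j.
  by rewrite !ord1 !mxE eqxx !mulr1n.
have := G0; rewrite at_block scalar_mx_block.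
case/eq_block_mx => a0 b0 c0 D0.
have {}a0 : a.[0] = 1 by have /matrixP/(_ 0 0) := a0; rewrite !mxE eqxx !mulr1n.
(* The Schur complement D - c a^-1 b is multiplied by the pivot a in order to stay polynomial; the
   curve still passes through the identity. *)
have [|q q0 qP] := IH (a *: D - c *m b).
  by rewrite mx_atB mx_atZ mx_atM a0 b0 D0 mulmx0 subr0 scale1r.
exists (q * a) => [|s].
  by rewrite mulf_neq0 //; apply: contra_eq_neq a0 => ->; rewrite horner0 eq_sym oner_neq0.
rewrite hornerM mulf_eq0 negb_or => /andP[/qP[L [U [Lt L1 Ut E]]] as0].
exists (block_mx 1%:M 0 (a.[s]^-1 *: mx_at s c) L).
exists (block_mx (a.[s])%:M (mx_at s b) 0 (a.[s]^-1 *: U)).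
split.
- by rewrite is_trig_block_mx // scalar_mx_is_trig Lt eqxx.
- move=> k; rewrite -[k]splitK; case: split => j /=.
    by rewrite block_mxEul mxE ord1 eqxx.
  by rewrite block_mxEdr L1.
- rewrite tr_block_mx is_trig_block_mx // trmx0 eqxx tr_scalar_mx.
  by rewrite scalar_mx_is_trig linearZ /=; apply/is_trig_mxP => i j ij;
     rewrite mxE (is_trig_mxP Ut) ?mulr0.
rewrite at_block mulmx_block !mul1mx !mul0mx !mulmx0 !addr0.
congr block_mx.
  by rewrite mul_mx_scalar scalerA divff // scale1r.
rewrite -scalemxAl -scalemxAr -scalerDr -E mx_atB mx_atZ mx_atM.
by rewrite addrC subrK scalerA mulVf // scale1r.
Qed.

Section Spanning.
Variables (F : numFieldType) (N d : nat) (P : 'M[{mpoly F[N * N]}]_d).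
Local Notation rho := (polymap P).
Hypothesis rho1 : rho 1%:M = 1%:M.
Hypothesis rhoM : {in unitmx &, {morph rho : g h / g *m h}}.
Variables (l : 'I_N -> nat) (v : 'cV[F]_d).
Hypothesis v_neq0 : v != 0.
Hypothesis vP : forall b : 'M[F]_N, b \in unitmx -> is_trig_mx b^T ->
  rho b *m v = (\prod_i b i i ^+ l i) *: v.
Hypothesis irr : forall W : {vspace 'cV[F]_d},
  (forall g w, g \in unitmx -> w \in W -> rho g *m w \in W) ->
  W = 0%VS \/ W = fullv.

(* [1 + s (g - 1)] lies in the big cell for all but finitely many [s]. *)
Lemma lower_unitriangular_dense (xi : 'rV[F]_d) :
  (forall u : 'M[F]_N, is_trig_mx u -> (forall i, u i i = 1) ->
     xi *m (rho u *m v) = 0) ->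
  forall g, g \in unitmx -> xi *m (rho g *m v) = 0.
Proof.
move=> xi0 g gu; pose G := mx_line (g - 1%:M).
have [|q q0 qP] := @lu_generic F N G; first by rewrite mx_lineE scale0r addr0.
pose f := map_mx polyC xi *m (polymap_curve P G *m map_mx polyC v).
have fE s : mx_at s f = xi *m (rho (mx_at s G) *m v).
  by rewrite !mx_atM !mx_at_polyC polymap_curveE.
suff /(congr1 (mx_at 1)) : f = 0.
  rewrite fE mx_lineE scale1r addrC subrK => ->.
  by apply/matrixP => i j; rewrite !mxE horner0.
apply: (mx_at_eq_generic (mulf_neq0 q0 (det_line_neq0 (g - 1%:M)))) => s.
rewrite hornerM mulf_eq0 negb_or => /andP[/qP[L [U [Lt L1 Ut E]]]].
rewrite -det_mx_at -/G fE E det_mulmx mulf_eq0 negb_or => /andP[Lu Uu].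
rewrite rhoM ?unitmxE ?unitfE // -mulmxA vP ?unitmxE ?unitfE //.
rewrite -scalemxAr -scalemxAr xi0 // scaler0.
by apply/matrixP => i j; rewrite !mxE horner0.
Qed.

(** Dual form of the fact that the lower unitriangular orbit of [v] spans: a form killing it kills
    the full orbit of [v], whose span is stable and nonzero. *)
Lemma lower_unitriangular_span (xi : 'rV[F]_d) :
  (forall u : 'M[F]_N, is_trig_mx u -> (forall i, u i i = 1) ->
     xi *m (rho u *m v) = 0) -> xi = 0.
Proof.
move=> /lower_unitriangular_dense xi0.
pose S (w : 'cV[F]_d) := exists2 g, g \in unitmx & w = rho g *m v.
have [X XS SX] := span_of_pred S.
have stab g w : g \in unitmx -> w \in <<X>>%VS -> rho g *m w \in <<X>>%VS.
  move=> gu /(coord_span (X := in_tuple X)) ->; rewrite mulmx_sumr.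
  apply: memv_suml => i _; rewrite -scalemxAr memvZ //; apply: SX.
  have [h hu ->] : S (in_tuple X)`_i by apply: XS; rewrite mem_nth.
  by exists (g *m h); rewrite ?unitmx_mul ?gu // rhoM // mulmxA.
have vX : v \in <<X>>%VS.
  by apply: SX; exists 1%:M; rewrite ?unitmx1 // rho1 mul1mx.
have [W0|WT] := irr stab; first by rewrite W0 memv0 (negPf v_neq0) in vX.
have xiX w : w \in <<X>>%VS -> xi *m w = 0.
  move=> /(coord_span (X := in_tuple X)) ->; rewrite mulmx_sumr big1 // => i _.
  have [h hu ->] : S (in_tuple X)`_i by apply: XS; rewrite mem_nth.
  by rewrite -scalemxAr xi0 ?scaler0.
apply/rowP => j; have := xiX (delta_mx j 0); rewrite WT memvf => /(_ isT).
by rewrite -colE => /matrixP/(_ 0 0); rewrite !mxE.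
Qed.
End Spanning.

Section LeadingWeight.
Variables (F : numFieldType) (N d : nat) (P : 'M[{mpoly F[N * N]}]_d).
Local Notation rho := (polymap P).
Local Notation dg t := (diag_mx (\row_i t i)).
Hypothesis rho1 : rho 1%:M = 1%:M.
Hypothesis rhoM : {in unitmx &, {morph rho : g h / g *m h}}.
Variables (l : 'I_N -> nat) (v : 'cV[F]_d).
Hypothesis v_neq0 : v != 0.
Hypothesis vP : forall b : 'M[F]_N, b \in unitmx -> is_trig_mx b^T ->
  rho b *m v = (\prod_i b i i ^+ l i) *: v.
Hypothesis irr : forall W : {vspace 'cV[F]_d},
  (forall g w, g \in unitmx -> w \in W -> rho g *m w \in W) ->
  W = 0%VS \/ W = fullv.
Variable a : 'I_N -> nat.
Hypothesis a_dec : forall i j : 'I_N, (i < j)%N -> (a j < a i)%N.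

Local Notation lm := [multinom l i | i < N].

Lemma rho_diag_hw (t : 'I_N -> F) : (forall i, t i != 0) ->
  rho (dg t) *m v = (\prod_i t i ^+ l i) *: v.
Proof.
move=> t0; rewrite vP ?diag_unit ?tr_diag_mx ?diag_mx_is_trig //.
by congr (_ *: _); apply: eq_bigr => i _; rewrite !mxE eqxx mulr1n.
Qed.

(* The conjugate of [u] by [diag(t_i s^(-a_i))], as a polynomial curve in [s]. *)
Definition contraction (t : 'I_N -> F) (u : 'M[F]_N) : 'M[{poly F}]_N :=
  \matrix_(i, j) ((t i * u i j / t j)%:P * 'X^(a j - a i)).

Lemma contraction0 t u : (forall i, t i != 0) ->
  is_trig_mx u -> (forall i, u i i = 1) -> mx_at 0 (contraction t u) = 1%:M.
Proof.
move=> t0 /is_trig_mxP ut u1; apply/matrixP => i j; rewrite !mxE hornerM hornerC.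
have [->|ij] := eqVneq i j.
  by rewrite subnn hornerXn expr0 u1 !mulr1 divff // t0.
rewrite hornerXn expr0n subn_eq0.
case: (ltngtP i j) ij => [ij _|ij _|/val_inj->]; last by rewrite eqxx.
- by rewrite ut // mulr0 !mul0r.
- by rewrite leqNgt a_dec // mulr0.
Qed.

(** With D the diagonal matrix on the left and Z the contraction at s, D u = Z D, and D acts on [v]
    by its weight. *)
Lemma rho_contraction t u s : (forall i, t i != 0) -> s != 0 ->
  is_trig_mx u -> (forall i, u i i = 1) ->
  rho (dg (fun i => t i * s^-1 ^+ a i)) *m (rho u *m v)
  = (\prod_i (t i * s^-1 ^+ a i) ^+ l i) *: (rho (mx_at s (contraction t u)) *m v).
Proof.
move=> t0 s0 ut u1; set Z := mx_at s _; set D := dg _.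
have trig_unit (w : 'M[F]_N) : is_trig_mx w -> (forall i, w i i = 1) -> w \in unitmx.
  by move=> wt w1; rewrite unitmxE unitfE det_trig // big1 ?oner_neq0.
have ts0 i : t i * s^-1 ^+ a i != 0 by rewrite mulf_neq0 // expf_neq0 // invr_neq0.
have Du : D \in unitmx by apply: diag_unit.
have uu : u \in unitmx by apply: trig_unit.
have Zu : Z \in unitmx.
  apply: trig_unit => [|i].
    apply/is_trig_mxP => i j ij; rewrite !mxE (is_trig_mxP ut) //.
    by rewrite mulr0 mul0r mul0r horner0.
  by rewrite !mxE subnn expr0 u1 !mulr1 divff // hornerC.
have E : D *m u = Z *m D.
  apply/matrixP => i j; rewrite mul_diag_mx mul_mx_diag !mxE hornerM hornerC hornerXn.
  case: (leqP j i) => ij; last by rewrite (is_trig_mxP ut) // !mulr0 !mul0r.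
  have aij : (a i <= a j)%N.
    by move: ij; rewrite leq_eqVlt => /predU1P[/val_inj-> //|/a_dec/ltnW].
  have tj := t0 j; have -> : s^-1 ^+ a i = s ^+ (a j - a i) * s^-1 ^+ a j.
    rewrite -[in s^-1 ^+ a j](subnK aij) exprD mulrA -exprMn divff // expr1n.
    by rewrite mul1r.
  by field.
by rewrite mulmxA -rhoM // E rhoM // -mulmxA rho_diag_hw // -scalemxAr.
Qed.

(** The coefficient of X^m in [torus_mx] plays the role of the projector onto the weight space of m.
    At the points t_i s^(-a_i), the m-component of rho(u) v scales as s^(-wt m), whereas by
    [rho_contraction] the whole vector is s^(-wt lm) times a polynomial in s with constant term a
    multiple of [v]. So no component lies above wt lm, and the only one at that level is [v]. *)
Lemma torus_coeff_lower u m : is_trig_mx u -> (forall i, u i i = 1) ->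
  (wt a lm <= wt a m)%N ->
  map_mx (mcoeff m) (torus_mx P) *m (rho u *m v) = if m == lm then v else 0.
Proof.
move=> ut u1 lem; apply/matrixP => k k0; rewrite !ord1 => {k0}.
set y := rho u *m v.
pose p : {mpoly F[N]} := \sum_j (y j 0) *: torus_mx P k j.
have pc m' : p@_m' = (map_mx (mcoeff m') (torus_mx P) *m y) k 0.
  rewrite mxE raddf_sum; apply: eq_bigr => j _ /=.
  by rewrite mcoeffZ [map_mx _ _ _ _]mxE mulrC.
have pe t : p.@[t] = (rho (dg t) *m y) k 0.
  rewrite -torus_mxE mxE rmorph_sum; apply: eq_bigr => j _ /=.
  by rewrite mevalZ [map_mx _ _ _ _]mxE mulrC.
rewrite -pc; clearbody p => {pc}.
set L := wt a lm in lem *.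
(* [B] bounds all weights in sight, so that multiplication by s^(B + L) clears the negative powers
   and the natural subtractions below are exact. *)
pose B := (L + \sum_(m' <- msupp p) wt a m')%N.
have leB m' : m' \in msupp p -> (wt a m' <= B)%N.
  move=> mp; rewrite /B (bigD1_seq m') ?msupp_uniq //=; lia.
have [mB|Bm] := leqP (wt a m) B; last first.
  rewrite memN_msupp_eq0; last by apply: contraL Bm => /leB; rewrite -leqNgt.
  have [ml|_] := eqVneq m lm; last by rewrite mxE.
  by move: Bm; rewrite ml -/L /B; lia.
have LB : (L <= B)%N by rewrite leq_addr.
pose E := wt a m; clearbody B.
(* The parameter s separates exponents only by their weight; within the level [E] they are separated
   by letting t vary. *)
pose g : {mpoly F[N]} := \sum_(m' <- msupp p | wt a m' == E) p@_m' *: 'X_[m'].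
have gm : g@_m = p@_m.
  rewrite /g raddf_sum /= big_mkcond /=.
  have [mp|mp] := boolP (m \in msupp p).
    rewrite (bigD1_seq m) ?msupp_uniq //= eqxx mcoeffZ mcoeffX eqxx mulr1.
    rewrite big1 ?addr0 // => m' /negPf m'm; case: eqP => // _.
    by rewrite mcoeffZ mcoeffX m'm mulr0.
  rewrite (memN_msupp_eq0 mp) big_seq big1 // => m' m'p; case: eqP => // _.
  rewrite mcoeffZ mcoeffX; case: eqP => [m'm|]; last by rewrite mulr0.
  by rewrite m'm (negPf mp) in m'p.
suff gE : g = (if E == L then v k 0 else 0) *: 'X_[lm].
  rewrite -gm gE mcoeffZ mcoeffX (eq_sym lm); have [ml|_] := eqVneq m lm.
    by rewrite /E ml eqxx mulr1.
  by rewrite mulr0 mxE.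
apply: (@mpoly_eq_torus _ _ 1); first exact: oner_neq0.
move=> t t0 _.
pose tm (m' : 'X_{1..N}) := \prod_i t i ^+ m' i.
pose yk := (polymap_curve P (contraction t u) *m map_mx polyC v) k 0.
have : \sum_(m' <- msupp p) (p@_m' * tm m') *: 'X^(B + L - wt a m')
     = tm lm *: ('X^B * yk) :> {poly F}.
  apply: (@poly_eq_generic _ 'X) => [|s]; first by rewrite polyX_eq0.
  rewrite hornerX => s0; have := rho_contraction t0 s0 ut u1.
  move=> /matrixP/(_ k 0); rewrite -pe [RHS]mxE => pE.
  have prodE (e : 'I_N -> nat) : \prod_i (t i * s^-1 ^+ a i) ^+ e i
      = \prod_i t i ^+ e i * s^-1 ^+ (\sum_i e i * a i).
    rewrite expr_sum -big_split; apply: eq_bigr => i _ /=.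
    by rewrite exprMn -exprM mulnC.
  have expE w : (w <= B + L)%N -> s ^+ (B + L - w) = s ^+ (B + L) * s^-1 ^+ w.
    move=> wB; rewrite -[in RHS](subnK wB) exprD -mulrA -exprMn divff //.
    by rewrite expr1n mulr1.
  transitivity (s ^+ (B + L) * p.@[fun i => t i * s^-1 ^+ a i]).
    rewrite horner_sum mevalE mulr_sumr big_seq [RHS]big_seq.
    apply: eq_bigr => m' m'p; rewrite hornerZ hornerXn prodE -/(wt a m') -/(tm m').
    rewrite expE ?(leq_trans (leB _ m'p)) ?leq_addr // -/(wt a m').
    by rewrite mulrCA !mulrA.
  have -> : s ^+ (B + L) = s ^+ B * s ^+ L by rewrite exprD.
  rewrite pE prodE -polymap_curveE hornerZ hornerM hornerXn.
  have -> : yk.[s] = (mx_at s (polymap_curve P (contraction t u)) *m v) k 0.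
    by rewrite -[v in RHS](mx_at_polyC s) -mx_atM mxE.
  have -> : tm lm = \prod_i t i ^+ l i by apply: eq_bigr => i _; rewrite mnmE.
  have -> : (\sum_i l i * a i)%N = L by apply: eq_bigr => i _; rewrite mnmE.
  have : s ^+ L * s^-1 ^+ L = 1 by rewrite -exprMn divff // expr1n.
  move: (s ^+ L) (s^-1 ^+ L) (s ^+ B) => x x' z xx'.
  move: (\prod_i _) (_ k 0) => w w'.
  by rewrite -[RHS]mul1r -xx'; ring.
(* The right-hand side is divisible by X^B, so this coefficient is zero when E > L; when E = L it is
   the constant term of [yk], given by the contraction at s = 0. *)
move=> /(congr1 (fun q : {poly F} => q`_(B + L - E))).
rewrite coefZ coefXnM coef_sum => gt.
transitivity (\sum_(m' <- msupp p) ((p@_m' * tm m') *: 'X^(B + L - wt a m'))`_(B + L - E)).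
  rewrite rmorph_sum big_mkcond big_seq [RHS]big_seq; apply: eq_bigr => m' m'p /=.
  rewrite coefZ coefXn mevalZ mevalX.
  have -> : (B + L - E == B + L - wt a m')%N = (wt a m' == E).
    by have := leB _ m'p; rewrite -/E in mB *; lia.
  by case: ifP => _; rewrite ?mulr1 ?mulr0.
rewrite {}gt mevalZ mevalX.
have -> : tm lm = \prod_i t i ^+ lm i by [].
rewrite mulrC; congr (_ * _); have [EL|EL] := eqVneq E L.
  rewrite EL addnK ltnn subnn -horner_coef0.
  have -> : yk.[0] = (mx_at 0 (polymap_curve P (contraction t u)) *m v) k 0.
    by rewrite -[v in RHS](mx_at_polyC 0) -mx_atM mxE.
  by rewrite polymap_curveE contraction0 // rho1 mul1mx.
by rewrite ifT //; move: EL lem mB; rewrite -/E; lia.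
Qed.

Lemma torus_coeff_zero m : (wt a lm <= wt a m)%N -> m != lm ->
  map_mx (mcoeff m) (torus_mx P) = 0.
Proof.
move=> lem /negPf mlm; apply/row_matrixP => i; rewrite row0.
apply: (lower_unitriangular_span rho1 rhoM v_neq0 vP irr) => u ut u1.
by rewrite -row_mul torus_coeff_lower // mlm row0.
Qed.

Lemma torus_charE_coeff m :
  (torus_char P)@_m = \tr (map_mx (mcoeff m) (torus_mx P)).
Proof. by rewrite [LHS]raddf_sum; apply: eq_bigr => k _; rewrite [RHS]mxE. Qed.

Lemma torus_char_dominated : dominated a lm (torus_char P).
Proof.
move=> m; rewrite torus_charE_coeff; have [->|mlm] := eqVneq m lm; first by left.
case: (ltnP (wt a m) (wt a lm)) => [|lem]; first by right.
by rewrite torus_coeff_zero // mxtrace0 eqxx.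
Qed.

(** The highest weight has multiplicity one: the coefficient matrix T sends every rho(u) v to [v],
    and these span, so T = v phi T for any form phi with phi(v) = 1. Its trace is phi(T v) = 1. *)
Lemma torus_char_lead : (torus_char P)@_lm = 1.
Proof.
rewrite torus_charE_coeff; set T := map_mx _ _.
have Tu u : is_trig_mx u -> (forall i, u i i = 1) -> T *m (rho u *m v) = v.
  by move=> ut u1; rewrite /T torus_coeff_lower // eqxx.
have Tv : T *m v = v.
  by rewrite -{1}[v]mul1mx -rho1 Tu ?scalar_mx_is_trig // => i; rewrite mxE eqxx.
have /existsP[k vk] : [exists k, v k 0 != 0].
  apply: contraNT v_neq0 => /existsPn v0; apply/eqP/colP => k.
  by rewrite mxE; apply/eqP; rewrite -[_ == _]negbK v0.
pose phi : 'rV[F]_d := (v k 0)^-1 *: delta_mx 0 k.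
have phiv : phi *m v = 1%:M.
  rewrite -scalemxAl -rowE; apply/matrixP => i j.
  by rewrite !ord1 !mxE eqxx mulVf.
have TE : T = v *m (phi *m T).
  apply/row_matrixP => i; apply/eqP; rewrite -subr_eq0; apply/eqP.
  apply: (lower_unitriangular_span rho1 rhoM v_neq0 vP irr) => u ut u1.
  rewrite -linearB /= -row_mul mulmxBl Tu // -!mulmxA Tu // phiv mulmx1.
  by rewrite subrr row0.
by rewrite TE mxtrace_mulC -mulmxA Tv phiv mxtrace1.
Qed.
End LeadingWeight.

(** * The Weyl character formula *)

Local Notation "m # s" := [multinom m (s i) | i < _]
  (at level 40, left associativity).

Section Antisymmetric.
Variables (F : numFieldType) (N : nat).
Implicit Types (p q : {mpoly F[N]}) (m : 'X_{1..N}).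

Definition antisymmetric p := forall s : 'S_N, msym s p = (-1) ^+ s *: p.

Lemma msym_eval (s : 'S_N) p t : (msym s p).@[t] = p.@[t \o s].
Proof.
elim/mpoly_alg_ind: p => [c|i|p q IHp IHq|p q IHp IHq].
- by rewrite -[c%:MP]mulr1 mul_mpolyC msymZ msym1 -mul_mpolyC mulr1 !mevalC.
- rewrite /msym mmapX mmap1U !mevalXU //.
- by rewrite msymD !mevalD IHp IHq.
by rewrite msymM !mevalM IHp IHq.
Qed.

Lemma alternant_antisymmetric l : antisymmetric (alternant F l).
Proof.
move=> s; apply/eqP; rewrite -subr_eq0; apply/eqP/mpoly_eval_eq0 => t.
rewrite mevalB mevalZ msym_eval !alternant_eval.
have -> : \matrix_(i, j) (t \o s) i ^+ l j
    = row_perm s (\matrix_(i, j) t i ^+ l j).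
  by apply/matrixP => i j; rewrite !mxE.
by rewrite row_permE det_mulmx det_perm subrr.
Qed.

Lemma antisymmetric_mcoeff p (s : 'S_N) m : antisymmetric p ->
  p@_(m#s) = (-1) ^+ s * p@_m.
Proof. by move=> /(_ s) /(congr1 (mcoeff m)); rewrite mcoeff_sym mcoeffZ. Qed.

Lemma antisymmetric_inj p m : antisymmetric p -> p@_m != 0 ->
  injective (fun i => m i).
Proof.
move=> ap pm i j mij; apply: contraTeq pm => ij; rewrite negbK.
have := antisymmetric_mcoeff (tperm i j) m ap.
have -> : m#(tperm i j) = m.
  by apply/mnmP => k; rewrite mnmE; case: tpermP => // ->.
rewrite odd_tperm ij expr1 mulN1r => /eqP.
by rewrite -addr_eq0 -mulr2n -mulr_natr mulf_eq0 pnatr_eq0 orbF.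
Qed.

Lemma exists_decreasing m : injective (fun i => m i) ->
  exists s : 'S_N, forall i j : 'I_N, (i < j)%N -> ((m#s) j < (m#s) i)%N.
Proof.
move=> m_inj; set t := [tuple m i | i < N].
have /tuple_permP[s sE] : perm_eq (sort geq t) t by rewrite perm_sort.
exists s => i j ij.
have nthE (k : 'I_N) : nth 0%N (sort geq t) k = (m#s) k.
  rewrite sE -[k in nth _ _ k]/(nat_of_ord k) (nth_mktuple (fun i => tnth t (s i))).
  by rewrite tnth_mktuple mnmE.
have sz : size (sort geq t) = N by rewrite size_sort size_tuple.
have le : ((m#s) j <= (m#s) i)%N.
  rewrite -!nthE; apply: (sorted_leq_nth (leT := geq)); rewrite ?inE ?sz //.
  - by move=> x y z /= yx xz; apply: leq_trans xz yx.
  - by move=> x /=.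
  - by apply: sort_sorted => x y; apply: leq_total.
  by apply: ltnW.
rewrite ltn_neqAle le andbT !mnmE; apply/eqP => /m_inj/perm_inj E.
by rewrite E ltnn in ij.
Qed.

Lemma decreasing_perm_eq (f : 'I_N -> nat) (s : 'S_N) :
  (forall i j : 'I_N, (i < j)%N -> (f j < f i)%N) ->
  (forall i j : 'I_N, (i < j)%N -> (f (s j) < f (s i))%N) -> f \o s =1 f.
Proof.
move=> fd fsd i.
have sorted_f (g : 'I_N -> nat) : (forall i j : 'I_N, (i < j)%N -> (g j < g i)%N) ->
    sorted gtn [seq g i | i <- enum 'I_N].
  move=> gd; rewrite sorted_map; apply: (@sub_sorted _ (relpre val ltn)).
    by move=> x y /= /gd.
  by rewrite -sorted_map val_enum_ord iota_ltn_sorted.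
have E : [seq f (s i) | i <- enum 'I_N] = [seq f i | i <- enum 'I_N].
  apply: (irr_sorted_eq (leT := gtn)).
  - by move=> x y z /= yx xz; apply: ltn_trans xz yx.
  - by move=> x /=; rewrite ltnn.
  - exact: (sorted_f (f \o s)).
  - exact: sorted_f.
  move=> x; apply/mapP/mapP => -[k _ ->]; first by exists (s k); rewrite ?mem_enum.
  by exists (s^-1%g k); rewrite ?mem_enum // permKV.
by move/eq_in_map: E => /(_ i); rewrite mem_enum; apply.
Qed.
End Antisymmetric.

Lemma stair_dec N (i j : 'I_N) : (i < j)%N -> (stair j < stair i)%N.
Proof. by rewrite /stair; have := ltn_ord j; lia. Qed.

Lemma decreasing_inj N (f : 'I_N -> nat) :
  (forall i j : 'I_N, (i < j)%N -> (f j < f i)%N) -> injective f.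
Proof.
by move=> fd i j E; apply/val_inj; case: (ltngtP i j) => // /fd; rewrite E ltnn.
Qed.

Section WeylFormula.
Variables (F : numFieldType) (N d : nat) (P : 'M[{mpoly F[N * N]}]_d).
Local Notation rho := (polymap P).
Local Notation dg t := (diag_mx (\row_i t i)).
Hypothesis rho1 : rho 1%:M = 1%:M.
Hypothesis rhoM : {in unitmx &, {morph rho : g h / g *m h}}.
Variables (l : 'I_N -> nat) (v : 'cV[F]_d).
Hypothesis l_noninc : forall i j : 'I_N, (i <= j)%N -> (l j <= l i)%N.
Hypothesis v_neq0 : v != 0.
Hypothesis vP : forall b : 'M[F]_N, b \in unitmx -> is_trig_mx b^T ->
  rho b *m v = (\prod_i b i i ^+ l i) *: v.
Hypothesis irr : forall W : {vspace 'cV[F]_d},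
  (forall g w, g \in unitmx -> w \in W -> rho g *m w \in W) ->
  W = 0%VS \/ W = fullv.

Local Notation chi := (torus_char P).
Local Notation Delta := (alternant F (@stair N)).
Local Notation ld := (fun i => l i + stair i)%N.

Lemma ld_dec (i j : 'I_N) : (i < j)%N -> (ld j < ld i)%N.
Proof. by move=> ij; rewrite -addnS leq_add ?stair_dec ?l_noninc // ltnW. Qed.

Lemma stair_alternant_neq0 : Delta != 0.
Proof.
apply/eqP => D0; have := mcoeff_alternant F (decreasing_inj (@stair_dec N)).
by rewrite D0 mcoeff0 => /esym/eqP; rewrite oner_eq0.
Qed.

Lemma stair_alternant_eval_inj t : Delta.@[t] != 0 -> injective t.
Proof.
have [c _ ->] := stair_alternant F N.
rewrite mevalZ mulf_eq0 negb_or rmorph_prod => /andP[_ /prodf_neq0 nz] i j tij.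
apply/val_inj; case: (ltngtP i j) => // ij.
  by have := nz (i, j) ij; rewrite /= mevalB !mevalXU tij subrr eqxx.
by have := nz (j, i) ij; rewrite /= mevalB !mevalXU tij subrr eqxx.
Qed.

Lemma laplacian_alternant f :
  laplacian (alternant F f) = (\sum_(i < N) f i ^ 2)%:R *: alternant F f.
Proof.
apply/mpolyP => m; rewrite mcoeff_laplacian mcoeffZ.
have [->|/mcoeff_alternant_neq0[s ->]] := eqVneq (alternant F f)@_m 0.
  by rewrite !mulr0.
congr (_%:R * _); rewrite [RHS](reindex_inj (@perm_inj _ s)).
by apply: eq_bigr => i _; rewrite mnmE.
Qed.

Lemma laplacianM p q : laplacian (p * q) = laplacian p * q
  + 2 *: (\sum_i theta i p * theta i q) + p * laplacian q :> {mpoly F[N]}.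
Proof.
rewrite /laplacian mulr_suml mulr_sumr scaler_sumr -!big_split.
apply: eq_bigr => i _ /=.
by rewrite !thetaM thetaD !thetaM -mul_mpolyC mpolyC_nat; ring.
Qed.

(** By [theta_stair] the cross term of the Laplacian of the product is exactly the first-order term
    of [torus_char_radial]. The eigenvalue is then the Casimir one plus |delta|^2, that is |l +
    delta|^2. *)
Lemma laplacian_char :
  laplacian (Delta * chi) = (\sum_i ld i ^ 2)%:R *: (Delta * chi).
Proof.
have cas := casimir_scalar rho1 rhoM v_neq0 vP irr.
apply: (mpoly_eq_torus stair_alternant_neq0) => t t0 /stair_alternant_eval_inj t_inj.
have := torus_char_radial rho1 rhoM cas t0 t_inj.
rewrite laplacianM laplacian_alternant !mevalD !mevalZ !mevalM mevalZ.
have -> : (\sum_i theta i Delta * theta i chi).@[t] = Delta.@[t]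
    * \sum_i \sum_(j | j != i) t i / (t i - t j) * (theta i chi).@[t].
  rewrite rmorph_sum mulr_sumr; apply: eq_bigr => i _ /=.
  by rewrite mevalM theta_stair // -mulrA -mulr_suml.
have -> : (\sum_i ld i ^ 2)%:R = casimir_eigenvalue F l + (\sum_i @stair N i ^ 2)%:R.
  rewrite /casimir_eigenvalue !natr_sum -big_split; apply: eq_bigr => i _ /=.
  by rewrite !natrX subrK.
set S := \sum_i _; set D := Delta.@[t]; set c := casimir_eigenvalue F l.
set L := (laplacian chi).@[t] => E.
transitivity (D * (L + 2 * S) + (\sum_i @stair N i ^ 2)%:R * (D * chi.@[t])).
  by move: (_%:R); move=> x; ring.
by rewrite E mulrDl; congr (_ + _); rewrite mulrCA.
Qed.

Lemma torus_char_sym (s : 'S_N) : msym s chi = chi.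
Proof.
apply: (@mpoly_eq_torus _ _ 1); first exact: oner_neq0.
move=> t t0 _; rewrite msym_eval !torus_charE.
have u : (perm_mx s : 'M[F]_N) \in unitmx by apply: unitmx_perm.
have -> : dg (t \o s) = perm_mx s *m dg t *m invmx (perm_mx s).
  apply: (can_inj (mulmxK u)); rewrite mulmxKV //.
  apply/matrixP => i j; by rewrite mul_diag_mx -row_permE !mxE mulr_natr.
rewrite !rhoM ?unitmx_mul ?u ?diag_unit // ?unitmx_inv //.
by rewrite mxtrace_mulC mulmxA (rhoV rho1 rhoM) // mul1mx.
Qed.

(** A nonzero antisymmetric difference would have a strictly decreasing exponent [nu], of the same
    norm as [ld] by the Laplacian. The functional that excludes it is built from [nu] itself. *)
Theorem weyl_character_poly : Delta * chi = alternant F ld.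
Proof.
apply/eqP; rewrite -subr_eq0; apply/eqP; set g := _ - _.
apply/mpolyP => m; rewrite mcoeff0; apply/eqP; apply: contraT => gm.
have ga : antisymmetric g.
  move=> s; rewrite msymB msymM torus_char_sym !alternant_antisymmetric.
  by rewrite -scalerAl -scalerBr.
have [s sd] := exists_decreasing (antisymmetric_inj ga gm).
set nu := (m#s)%MM in sd *.
have gnu : g@_nu != 0.
  by rewrite antisymmetric_mcoeff // mulf_neq0 // signr_eq0.
have fdom := torus_char_dominated rho1 rhoM v_neq0 vP irr.
have flead := torus_char_lead rho1 rhoM v_neq0 vP irr.
set la := [multinom ld i | i < N].
have laE : la = ([multinom stair i | i < N] + [multinom l i | i < N])%MM.
  by apply/mnmP => i; rewrite mnmDE !mnmE addnC.
have normE : (\sum_i nu i ^ 2 = \sum_i ld i ^ 2)%N.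
  have : laplacian g = (\sum_i ld i ^ 2)%:R *: g.
    apply/mpolyP => m'; rewrite mcoeff_laplacian mcoeffZ /g !mcoeffB !mulrBr.
    by rewrite -mcoeff_laplacian laplacian_char mcoeffZ -mcoeff_laplacian
       laplacian_alternant mcoeffZ.
  move=> /(congr1 (mcoeff nu)); rewrite mcoeff_laplacian mcoeffZ => /(mulIf gnu)/eqP.
  by rewrite eqr_nat => /eqP.
(* For [a = nu + ld], domination gives [<nu, a> < <ld, a>], that is
   [|nu|^2 < |ld|^2]. *)
pose a i := (nu i + ld i)%N.
have a_dec (i j : 'I_N) : (i < j)%N -> (a j < a i)%N.
  by move=> ij; rewrite /a; have := sd _ _ ij; have := ld_dec ij; lia.
have [] := dominatedM (dominated_stair a_dec) (fdom a a_dec).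
rewrite -laE => fd.
rewrite (mcoeff_alternant F (decreasing_inj (@stair_dec N))) (flead a a_dec) mulr1 => f1.
have nula : nu != la.
  apply: contraNneq gnu => ->.
  by rewrite /g mcoeffB f1 (mcoeff_alternant F (decreasing_inj ld_dec)) subrr.
(* Two strictly decreasing arrangements of the same values coincide, so [nu] could be an exponent of
   the alternant only by being [ld]. *)
have f'0 : (alternant F ld)@_nu = 0.
  apply/eqP; apply: contraT => /mcoeff_alternant_neq0[r nuE].
  case/eqP: nula; rewrite nuE; apply/mnmP => i; rewrite !mnmE.
  apply: (decreasing_perm_eq ld_dec) => {}i j ij.
  by have := sd _ _ ij; rewrite nuE !mnmE.
move: gnu; rewrite /g mcoeffB f'0 subr0 => /fd[E|]; first by rewrite E eqxx in nula.
have -> : wt a nu = (\sum_i nu i ^ 2 + \sum_i nu i * ld i)%N.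
  by rewrite /wt -big_split; apply: eq_bigr => i _; rewrite /a /=; lia.
have -> : wt a la = (\sum_i ld i ^ 2 + \sum_i nu i * ld i)%N.
  by rewrite /wt -big_split; apply: eq_bigr => i _; rewrite /a mnmE /=; lia.
by rewrite normE ltnn.
Qed.
End WeylFormula.

(** * From polynomial to rational representations *)

Section TorusFormula.
Variables (F : numFieldType) (N : nat) (rho : gl_rep F N) (lam : 'I_N -> int).
Hypotheses (rho_irr : gl_irreducible rho) (rho_hw : has_highest_weight rho lam).
Local Notation dg t := (diag_mx (\row_i t i)).

Definition generic_mx : 'M[{mpoly F[N * N]}]_N :=
  \matrix_(i, j) 'X_(mxvec_index i j).

Lemma generic_mxE (g : 'M[F]_N) :
  map_mx (meval (fun l => mxvec g 0 l)) generic_mx = g.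
Proof. by apply/matrixP => i j; rewrite !mxE mevalXU mxvecE. Qed.

Lemma det_generic_mx (g : 'M[F]_N) :
  (\det generic_mx).@[fun l => mxvec g 0 l] = \det g.
Proof.
by rewrite -(det_map_mx (meval (fun l => mxvec g 0 l))) generic_mxE.
Qed.

(* Twisting by a power of the determinant makes the matrix coefficients
   polynomial and the highest weight nonnegative. *)
Lemma polynomial_twist : exists (k : nat) (P : 'M[{mpoly F[N * N]}]_(gl_dim rho)),
  (forall i, 0 <= lam i + k%:Z) /\
  forall g, g \in unitmx -> polymap P g = (\det g) ^+ k *: rho g.
Proof.
have /fin_all_exists[pk pkP] : forall ij : 'I_(gl_dim rho) * 'I_(gl_dim rho),
    exists pk : {mpoly F[N * N]} * nat, forall g, g \in unitmx ->
    rho g ij.1 ij.2 = pk.1.@[fun l => mxvec g 0 l] / (\det g) ^+ pk.2.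
  by move=> [i j]; have [p [k E]] := @gl_regular _ _ rho i j; exists (p, k).
pose k := (\sum_ij (pk ij).2 + \sum_i `|lam i|)%N.
exists k, (\matrix_(i, j) ((pk (i, j)).1 * (\det generic_mx) ^+ (k - (pk (i, j)).2))).
split=> [i|g gu].
  have : (`|lam i| <= k)%N by rewrite /k (bigD1 i) //=; lia.
  by lia.
apply/matrixP => i j; rewrite !mxE mevalM rmorphXn /= det_generic_mx.
rewrite (pkP (i, j)) //= mulrCA; congr (_ * _).
have dg0 : \det g != 0 by rewrite -unitfE -unitmxE.
have le : ((pk (i, j)).2 <= k)%N by rewrite /k (bigD1 (i, j)) //= -addnA leq_addr.
by rewrite -{2}(subnK le) exprD mulfK // expf_neq0.
Qed.

(** The twist multiplies both the character and the numerator alternant by det^k, which cancels. The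
    product form remains valid where some t_i coincide. *)
Theorem weyl_character_torus (t : 'I_N -> F) : (forall i, t i != 0) ->
  gl_character rho (dg t) * \det (\matrix_(i, j) t i ^+ stair j)
  = \det (\matrix_(i, j) t i ^ (lam j + delta j)).
Proof.
move=> t0; have [k [P [lamk PE]]] := polynomial_twist.
case: rho_hw => lam_ni [v v0 vP]; case: rho_irr => _ irr.
have [l lE] : exists l : 'I_N -> nat, forall i, (l i)%:Z = lam i + k%:Z.
  by exists (fun i => absz (lam i + k%:Z)%R) => i; rewrite gez0_abs.
have rho1 : polymap P 1%:M = 1%:M.
  by rewrite PE ?unitmx1 // det1 expr1n scale1r gl_act1.
have rhoM : {in unitmx &, {morph polymap P : g h / g *m h}}.
  move=> g h gu hu; rewrite !PE ?unitmx_mul ?gu // gl_actM // det_mulmx exprMn.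
  by rewrite -scalemxAl -scalemxAr scalerA.
have vP' b : b \in unitmx -> is_trig_mx b^T ->
    polymap P b *m v = (\prod_i b i i ^+ l i) *: v.
  move=> bu bt; rewrite PE // -scalemxAl vP // scalerA; congr (_ *: _).
  have bii i : b i i != 0.
    move: bu; rewrite unitmxE -det_tr det_trig // unitfE => /prodf_neq0/(_ i isT).
    by rewrite mxE.
  rewrite -det_tr det_trig // -prodrXl -big_split; apply: eq_bigr => i _ /=.
  by rewrite mxE !exprnP lE expfzDr // mulrC.
have irr' (W : {vspace 'cV[F]_(gl_dim rho)}) :
    (forall g w, g \in unitmx -> w \in W -> polymap P g *m w \in W) ->
    W = 0%VS \/ W = fullv.
  move=> WP; apply: irr => g w gu wW.
  have dg0 : \det g ^+ k != 0 by rewrite expf_neq0 // -unitfE -unitmxE.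
  have -> : rho g = (\det g ^+ k)^-1 *: polymap P g.
    by rewrite PE // scalerA mulVf // scale1r.
  by rewrite -scalemxAl memvZ // WP.
have l_ni (i j : 'I_N) : (i <= j)%N -> (l j <= l i)%N.
  by move=> /lam_ni; rewrite -lez_nat !lE lerD2r.
have := weyl_character_poly rho1 rhoM l_ni v0 vP' irr'.
move=> /(congr1 (meval t)); rewrite mevalM !alternant_eval torus_charE.
rewrite PE ?diag_unit // linearZ /= -/(gl_character rho _) mulrCA.
have -> : \det (\matrix_(i, j) t i ^+ (l j + stair j))
    = \det (dg t) ^+ k * \det (\matrix_(i, j) t i ^ (lam j + delta j)).
  have -> : \det (dg t) ^+ k = \det (dg (fun i => t i ^+ k)).
    by rewrite !det_diag -prodrXl; apply: eq_bigr => i _; rewrite !mxE.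
  rewrite -det_mulmx; congr (\det _); apply/matrixP => i j.
  rewrite mul_diag_mx !mxE !exprnP -!expfzDr //; congr (_ ^ _).
  by have := lE j; rewrite /delta /stair; lia.
move=> /(mulfI _) <-; first by rewrite mulrC.
by rewrite expf_neq0 // -unitfE -unitmxE diag_unit.
Qed.
End TorusFormula.

(** * Regular class functions *)

Section RegularFunctions.
Variable F : numFieldType.
Local Notation dg t := (diag_mx (\row_i t i)).

(** The denominator is any polynomial without zeros on invertible matrices, instead of a power of
    the determinant; stability under products and substitutions is then immediate. *)
Definition regular N (f : 'M[F]_N -> F) := exists p q : {mpoly F[N * N]},
  forall g, g \in unitmx -> q.@[fun l => mxvec g 0 l] != 0
    /\ f g * q.@[fun l => mxvec g 0 l] = p.@[fun l => mxvec g 0 l].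

Lemma regular_cst N c : regular (fun _ : 'M[F]_N => c).
Proof. by exists c%:MP, 1 => g _; rewrite meval1 mevalC mulr1 oner_neq0. Qed.

Lemma regularM N (f h : 'M[F]_N -> F) :
  regular f -> regular h -> regular (fun g => f g * h g).
Proof.
move=> [p [q fP]] [p' [q' hP]]; exists (p * p'), (q * q') => g gu.
have [q0 fE] := fP g gu; have [q'0 hE] := hP g gu.
by rewrite !mevalM mulf_neq0 // -fE -hE mulrACA.
Qed.

Lemma regularB N (f h : 'M[F]_N -> F) :
  regular f -> regular h -> regular (fun g => f g - h g).
Proof.
move=> [p [q fP]] [p' [q' hP]]; exists (p * q' - p' * q), (q * q') => g gu.
have [q0 fE] := fP g gu; have [q'0 hE] := hP g gu.
by rewrite mevalB !mevalM mulf_neq0 // -fE -hE; split=> //; ring.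
Qed.

Lemma regular_prod N I (r : seq I) (f : I -> 'M[F]_N -> F) :
  (forall i, regular (f i)) -> regular (fun g => \prod_(i <- r) f i g).
Proof.
move=> fr; elim: r => [|i r [p [q E]]].
  have [p [q E]] := regular_cst N 1; exists p, q => g /E; by rewrite big_nil.
have [p' [q' E']] : regular (fun g => f i g * \prod_(i <- r) f i g).
  by apply: regularM => //; exists p, q.
by exists p', q' => g /E'; rewrite big_cons.
Qed.

Lemma regular_comp N M (Phi : 'M[{mpoly F[N * N]}]_M) (f : 'M[F]_M -> F) :
  (forall g : 'M[F]_N, g \in unitmx -> polymap Phi g \in unitmx) ->
  regular f -> regular (fun g => f (polymap Phi g)).
Proof.
move=> Phiu [p [q fP]].
pose sub (r : {mpoly F[M * M]}) := r \mPo [tuple mxvec Phi 0 l | l < M * M].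
have subE r g : (sub r).@[fun l => mxvec g 0 l]
    = r.@[fun l => mxvec (polymap Phi g) 0 l].
  rewrite comp_mpoly_meval; apply: meval_eq => l; rewrite tnth_mktuple.
  by case/mxvec_indexP: l => a b; rewrite !mxvecE mxE.
by exists (sub p), (sub q) => g gu; rewrite !subE; apply: fP; apply: Phiu.
Qed.

Lemma regular_character N (rho : gl_rep F N) : regular (gl_character rho).
Proof.
suff [k [P PE]] : exists (k : nat) (P : 'M[{mpoly F[N * N]}]_(gl_dim rho)),
    forall g, g \in unitmx -> polymap P g = (\det g) ^+ k *: rho g.
  exists (\tr P), ((\det (generic_mx F N)) ^+ k) => g gu.
  rewrite rmorphXn /= det_generic_mx; split.
    by rewrite expf_neq0 // -unitfE -unitmxE.
  by rewrite -(trace_map_mx (meval _)) -/(polymap P g) PE // linearZ mulrC.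
by have [k [P [_ PE]]] := polynomial_twist rho (fun=> 0); exists k, P.
Qed.

(** Along the curve the numerator of [f] is a polynomial in s with infinitely many zeros, hence
    zero, while the denominator is nonzero at s0. *)
Lemma regular_curve N (f : 'M[F]_N -> F) (G : 'M[{poly F}]_N) (q : {poly F}) s0 :
  regular f -> q != 0 -> mx_at s0 G \in unitmx ->
  (forall s, q.[s] != 0 -> mx_at s G \in unitmx -> f (mx_at s G) = 0) ->
  f (mx_at s0 G) = 0.
Proof.
move=> [p [r fP]] q0 G0 fG.
have evE (h : {mpoly F[N * N]}) s : (mmap polyC (fun l => mxvec G 0 l) h).[s]
    = h.@[fun l => mxvec (mx_at s G) 0 l].
  rewrite horner_mmap; apply: meval_eq => l.
  by case/mxvec_indexP: l => a b; rewrite !mxvecE mxE.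
have p0 : mmap polyC (fun l => mxvec G 0 l) p = 0.
  apply: (@poly_eq_generic _ (q * \det G)) => [|s].
    rewrite mulf_neq0 //; apply: contraTneq G0 => dG0.
    by rewrite unitmxE det_mx_at dG0 horner0 unitr0.
  rewrite hornerM mulf_eq0 negb_or -det_mx_at => /andP[qs ds].
  have Gu : mx_at s G \in unitmx by rewrite unitmxE unitfE.
  by rewrite horner0 evE; have [_ <-] := fP _ Gu; rewrite fG // mul0r.
have [r0 /eqP] := fP _ G0; rewrite -(evE p) p0 horner0 mulf_eq0 (negPf r0) orbF.
by move/eqP.
Qed.

Definition class_function N (f : 'M[F]_N -> F) :=
  forall g h, g \in unitmx -> h \in unitmx -> f (h *m g *m invmx h) = f g.

Lemma class_function_character N (rho : gl_rep F N) :
  class_function (gl_character rho).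
Proof.
move=> g h gu hu; rewrite /gl_character !gl_actM ?unitmx_mul ?unitmx_inv ?hu //.
rewrite mxtrace_mulC mulmxA -gl_actM ?unitmx_inv // mulVmx // gl_act1.
by rewrite mul1mx.
Qed.

(* Conjugating by [diag(s^i)] multiplies the [(i, j)] entry by [s^(i-j)], so the
   closure of the conjugacy class of [T] contains its diagonal part. *)
Lemma class_function_trig N (f : 'M[F]_N -> F) (T : 'M[F]_N) :
  regular f -> class_function f -> T \in unitmx -> is_trig_mx T ->
  f T = f (dg (fun i => T i i)).
Proof.
move=> fr fc Tu Tt.
pose G : 'M[{poly F}]_N := \matrix_(i, j) ((T i j)%:P * 'X^(i - j)).
have G0 : mx_at 0 G = dg (fun i => T i i).
  apply/matrixP => i j; rewrite !mxE hornerM hornerC hornerXn.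
  have [->|ij] := eqVneq i j; first by rewrite subnn mulr1 mulr1n.
  rewrite mulr0n; case: (ltngtP i j) ij => [ij _|ij _|/val_inj->]; last by rewrite eqxx.
    by rewrite (is_trig_mxP Tt) // mul0r.
  by rewrite expr0n subn_eq0 leqNgt ij mulr0.
have Gs s : s != 0 -> exists2 h, h \in unitmx & mx_at s G = h *m T *m invmx h.
  move=> s0; have hu : dg (fun i : 'I_N => s ^+ i) \in unitmx.
    by apply: diag_unit => i; rewrite expf_neq0.
  exists (dg (fun i : 'I_N => s ^+ i)) => //.
  apply: (can_inj (mulmxK hu)); rewrite mulmxKV //; apply/matrixP => i j.
  rewrite mul_mx_diag mul_diag_mx !mxE hornerM hornerC hornerXn.
  case: (leqP j i) => ij; last by rewrite (is_trig_mxP Tt) // !mul0r mulr0.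
  by rewrite -mulrA -exprD subnK // mulrC.
apply/eqP; rewrite eq_sym -subr_eq0 -G0; apply/eqP.
apply: (regular_curve (f := fun g => f g - f T) (q := 'X)).
- by apply: regularB => //; apply: regular_cst.
- by rewrite polyX_eq0.
- rewrite G0 diag_unit // => i.
  by move: Tu; rewrite unitmxE det_trig // unitfE => /prodf_neq0; apply.
move=> s; rewrite hornerX => /Gs[h hu ->] _.
by rewrite fc // subrr.
Qed.

Lemma regular_diag_eq0 N (f : 'M[F]_N -> F) (r : {mpoly F[N]}) :
  regular f -> r != 0 ->
  (forall t, (forall i, t i != 0) -> r.@[t] != 0 -> f (dg t) = 0) ->
  forall t, (forall i, t i != 0) -> f (dg t) = 0.
Proof.
move=> [p [q fP]] r0 f0 t t0.
pose D : 'M[{mpoly F[N]}]_N := diag_mx (\row_i 'X_i).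
have DE t' : (p \mPo [tuple mxvec D 0 l | l < N * N]).@[t']
    = p.@[fun l => mxvec (dg t') 0 l].
  rewrite comp_mpoly_meval; apply: meval_eq => l; rewrite tnth_mktuple.
  case/mxvec_indexP: l => a b; rewrite !mxvecE !mxE.
  by case: eqP => _; rewrite ?mulr1n ?mulr0n ?mevalXU ?meval0.
have p0 : p \mPo [tuple mxvec D 0 l | l < N * N] = 0.
  apply: (mpoly_eq_torus r0) => t' t'0 rt'; rewrite DE meval0.
  by have [_ <-] := fP _ (diag_unit t'0); rewrite f0 // mul0r.
have [q0 /eqP] := fP _ (diag_unit t0).
by rewrite -DE p0 meval0 mulf_eq0 (negPf q0) orbF => /eqP.
Qed.
End RegularFunctions.

(** Schur's theorem conjugates [g] to a triangular matrix, [class_function_trig] replaces that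
    matrix by its diagonal part, and on the torus vanishing off the zeros of [r] suffices. *)
Lemma class_function_eq0 (F : numClosedFieldType) N (f : 'M[F]_N -> F) (r : {mpoly F[N]}) :
  regular f -> class_function f -> r != 0 ->
  (forall t, (forall i, t i != 0) -> r.@[t] != 0 -> f (diag_mx (\row_i t i)) = 0) ->
  forall g, g \in unitmx -> f g = 0.
Proof.
move=> fr fc r0 f0 g gu; have fd := regular_diag_eq0 fr r0 f0.
case: (posnP N) => [N0|N_gt0].
  have -> : g = diag_mx (\row_i (fun=> 1) i).
    by apply/matrixP => i; have := ltn_ord i; rewrite {2}N0.
  by apply: fd => i; apply: oner_neq0.
have [Q Qu] := Schur g N_gt0.
have {}Qu := unitarymx_unit Qu; rewrite /similar_to /= conjumx // => Tt.
have Tu : Q *m g *m invmx Q \in unitmx by rewrite !unitmx_mul Qu gu unitmx_inv.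
rewrite -(fc g Q) // (class_function_trig fr fc Tu Tt) fd // => i.
by move: Tu; rewrite unitmxE det_trig // unitfE => /prodf_neq0; apply.
Qed.

(** * The Coxeter element *)

Section Determinants.
Variable F : fieldType.

(** It serves reindexings between the orders n * m and m * n, equal only propositionally. The sign
    is chosen before [A]: it must not vary with the torus point. *)
Lemma det_mxsub p q (f g : 'I_p -> 'I_q) : p = q -> injective f -> injective g ->
  exists2 eps : F, eps = 1 \/ eps = -1 &
    forall A : 'M[F]_q, \det (mxsub f g A) = eps * \det A.
Proof.
move=> pq f_inj g_inj; move: f g f_inj g_inj; case: _ / pq => f g f_inj g_inj.
pose s := perm f_inj; pose r := perm g_inj.
exists ((-1) ^+ s * (-1) ^+ r).
  rewrite -signr_addb; case: (_ (+) _); rewrite ?expr0 ?expr1; by [right | left].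
move=> A; have -> : mxsub f g A = row_perm s (col_perm r A).
  by apply/matrixP => i j; rewrite !mxE !permE.
by rewrite row_permE col_permE !det_mulmx !det_perm odd_permV [\det A * _]mulrC mulrA.
Qed.

(** Indices are paired as in the tensor product, so that these matrices can be multiplied by [*t]
    products entrywise. *)
Definition blockdiag_mx n m (A : 'I_n -> 'M[F]_m) : 'M[F]_(n * m) :=
  \matrix_(r, s) if (mxtens_unindex r).1 == (mxtens_unindex s).1
    then A (mxtens_unindex r).1 (mxtens_unindex r).2 (mxtens_unindex s).2 else 0.

Lemma det_blockdiag n m (A : 'I_n -> 'M[F]_m) :
  \det (blockdiag_mx A) = \prod_b \det (A b).
Proof.
elim: n A => [|n IH] A; first by rewrite big_ord0 [LHS]det_mx00.
rewrite big_ord_recl -IH -(@det_ublock _ m (n * m) _ 0); congr (\det _).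
have unl (j : 'I_m) : @mxtens_unindex n.+1 m (lshift (n * m) j) = (ord0, j).
  by congr pair; apply/val_inj; rewrite /= ?divn_small ?modn_small.
have unr (k : 'I_(n * m)) : @mxtens_unindex n.+1 m (rshift m k)
    = (lift ord0 (mxtens_unindex k).1, (mxtens_unindex k).2).
  have m_gt0 : (0 < m)%N by case: (m) k => // -[k]; rewrite muln0.
  by congr pair; apply/val_inj; rewrite /= ?divnDl ?divnn ?m_gt0 ?modnDl.
apply/matrixP => r s; rewrite -[r]splitK -[s]splitK.
case: (split r) => r'; case: (split s) => s' /=.
- by rewrite block_mxEul mxE unl unl eqxx.
- by rewrite block_mxEur !mxE unl unr.
- by rewrite block_mxEdl !mxE unl unr.
by rewrite block_mxEdr !mxE !unr /= (inj_eq lift_inj).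
Qed.
End Determinants.

(** X^n - 1 is separable because n is nonzero in the field; the enumeration of its roots is
    arbitrary. *)
Lemma exists_unity_roots (C : closedFieldType) n : (0 < n)%N -> n%:R != 0 :> C ->
  exists z : 'I_n -> C, injective z /\ forall a, z a ^+ n = 1.
Proof.
move=> n_gt0 n0; have [r rE] := closed_field_poly_normal ('X^n - 1 : {poly C}).
have mon : 'X^n - 1 \is @monic C by rewrite monicXnsubC.
rewrite (monicP mon) scale1r in rE.
have ur : uniq r by rewrite -separable_prod_XsubC -rE separable_Xn_sub_1.
have sr : size r = n.
  by have := size_XnsubC (1 : C) n_gt0; rewrite rE size_prod_XsubC => -[].
exists (fun a => r`_a); split=> [a b /eqP|a].
  by rewrite nth_uniq ?sr // => /eqP/val_inj.
have : root ('X^n - 1) r`_a by rewrite rE root_prod_XsubC mem_nth ?sr.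
by rewrite /root !hornerE subr_eq0 => /eqP.
Qed.

Section CoxeterElement.
Variables (C : numClosedFieldType) (m n : nat) (z : 'I_n -> C).
Hypotheses (n_gt0 : (0 < n)%N) (m_gt0 : (0 < m)%N).
Hypotheses (z_inj : injective z) (z_root : forall a, z a ^+ n = 1).
Local Notation dg t := (diag_mx (\row_i t i)).

Definition fourier_mx : 'M[C]_n := \matrix_(a, b) z a ^+ b.

Lemma z_neq0 a : z a != 0.
Proof.
apply: contra_eq_neq (z_root a) => ->.
by rewrite expr0n gtn_eqF // eq_sym oner_neq0.
Qed.

Lemma fourier_unit : fourier_mx \in unitmx.
Proof.
have -> : fourier_mx = (Vandermonde n (\row_a z a))^T.
  by apply/matrixP => a b; rewrite !mxE.
rewrite unitmx_tr unitmxE unitfE det_Vandermonde.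
apply/prodf_neq0 => i _; apply/prodf_neq0 => j ij; rewrite !mxE subr_eq0.
by apply: contraTneq ij => /z_inj ->; rewrite ltnn.
Qed.

Lemma coxeter_mx_diag :
  coxeter_mx C n *m fourier_mx^T = fourier_mx^T *m dg z.
Proof.
apply/matrixP => i a; rewrite -row_permE mul_mx_diag !mxE permE -exprSr /=.
(* The cyclic successor is (i + 1) mod n, and the discarded multiple of n is invisible to an n-th
   root of unity. *)
by rewrite [in RHS](divn_eq i.+1 n) exprD mulnC exprM z_root expr1n mul1r.
Qed.

Lemma coxeter_class_diag c : coxeter_class c ->
  exists2 Q : 'M[C]_n, Q \in unitmx & c = Q *m dg z *m invmx Q.
Proof.
move=> [P Pu ->]; have Fu : fourier_mx^T \in unitmx by rewrite unitmx_tr fourier_unit.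
have PFu : P *m fourier_mx^T \in unitmx by rewrite unitmx_mul Pu.
exists (P *m fourier_mx^T) => //.
apply: (can_inj (mulmxK PFu)); rewrite mulmxKV // -!mulmxA mulKmx //.
by rewrite coxeter_mx_diag.
Qed.

Definition coxeter_torus (t : 'I_m -> C) (r : 'I_(m * n)) : C :=
  t (mxtens_unindex r).1 * z (mxtens_unindex r).2.

Lemma tens_dg t : dg t *t dg z = dg (coxeter_torus t).
Proof.
apply/matrixP => r s; case: (mxtens_indexP r) => i a; case: (mxtens_indexP s) => k b.
rewrite tensmxE !mxE /coxeter_torus !mxtens_indexK (inj_eq (can_inj (@mxtens_indexK m n))).
by rewrite xpair_eqE; do 2 case: eqP => _; rewrite /= ?mulr1n ?mulr0n ?mul0r ?mulr0.
Qed.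

Lemma tens_unit (t : 'M[C]_m) (c : 'M[C]_n) :
  t \in unitmx -> c \in unitmx -> t *t c \in unitmx.
Proof. by apply: tensmx_unit; rewrite -lt0n. Qed.

Lemma character_tens_class (rho : gl_rep C (m * n)) (Q : 'M[C]_n) t :
  Q \in unitmx -> (forall i, t i != 0) ->
  gl_character rho (dg t *t (Q *m dg z *m invmx Q))
  = gl_character rho (dg (coxeter_torus t)).
Proof.
move=> Qu t0; have z0 := z_neq0.
pose h : 'M[C]_(m * n) := (1%:M : 'M[C]_m) *t Q.
have hu : h \in unitmx by rewrite tens_unit ?unitmx1.
rewrite -(class_function_character rho (g := dg (coxeter_torus t)) (h := h)) //.
  congr gl_character; apply: (can_inj (mulmxK hu)); rewrite mulmxKV //.
  by rewrite -tens_dg /h !tensmx_mul mul1mx mulmx1 mulmxKV.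
by apply: diag_unit => r; rewrite mulf_neq0.
Qed.

Definition coxeter_alternant (e : 'I_(m * n) -> int) (t : 'I_m -> C) : C :=
  \det (\matrix_(r, c) coxeter_torus t r ^ e c).

Lemma modz_ord (b : 'I_n) : (b%:Z %% n)%Z = b%:Z.
Proof. by rewrite modz_small //= ltz_nat ltn_ord. Qed.

Lemma z_expz a (e : int) (b : 'I_n) : (e == b %[mod n])%Z -> z a ^ e = z a ^+ b.
Proof.
move=> /eqP eb; have z0 := z_neq0 a.
rewrite (divz_eq e n) eb expfzDr // [(e %/ n)%Z * _]mulrC -exprz_exp.
rewrite -exprnP z_root exp1rz mul1r.
by rewrite modz_ord.
Qed.

Section Distributed.
Variables (e : 'I_(m * n) -> int) (g : 'I_n -> 'I_m -> 'I_(m * n)).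
Variable q : 'I_n -> 'I_m -> int.
Hypothesis eg : forall b k, e (g b k) = n%:Z * q b k + b%:Z.
Hypothesis q_inj : forall b, injective (q b).

(** With rows indexed by (a, i) and columns by (b, k), the entry is z_a^b t_i^b (t_i^n)^(q b k), so
    the matrix is a Fourier factor times a block diagonal one. The parenthesized factor is
    independent of [e] and will cancel against the one for delta. *)
Lemma coxeter_alternant_distributed :
  exists2 eps : C, eps = 1 \/ eps = -1 & forall t, (forall i, t i != 0) ->
    coxeter_alternant e t = eps *
     (\det (fourier_mx *t (1%:M : 'M[C]_m)) * \prod_(b < n) \prod_i t i ^+ b) *
     \prod_b \det (\matrix_(i, k) (t i ^+ n) ^ q b k).
Proof.
(* [f] exchanges the two tensor factors of the row index; [h] lists the columns residue by
   residue. *)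
pose f (r : 'I_(n * m)) : 'I_(m * n) :=
  mxtens_index ((mxtens_unindex r).2, (mxtens_unindex r).1).
pose h (r : 'I_(n * m)) := g (mxtens_unindex r).1 (mxtens_unindex r).2.
have f_inj : injective f.
  move=> r s /(can_inj (@mxtens_indexK _ _)) [E2 E1].
  apply: (can_inj (@mxtens_unindexK _ _)).
  by rewrite [LHS]surjective_pairing [RHS]surjective_pairing; congr pair; apply/val_inj.
have h_inj : injective h.
  move=> r s /(congr1 e); rewrite /h !eg.
  case: (mxtens_indexP r) => b k; case: (mxtens_indexP s) => b' k'.
  rewrite !mxtens_indexK /= => E.
  have bb : b = b'.
    apply/val_inj; have := congr1 (modz^~ n) E.
    by rewrite ![(n%:Z * _)]mulrC !modzMDl !modz_ord => -[].
  rewrite bb in E *; congr (mxtens_index (_, _)).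
  by move: E => /addIr/mulfI -/(_ _)/q_inj ->; rewrite // eqz_nat -lt0n.
have [eps epsP E] := @det_mxsub C _ _ f h (mulnC n m) f_inj h_inj.
exists eps => // t t0.
have eps2 : eps * eps = 1 by case: epsP => ->; rewrite ?mulr1 ?mulrNN ?mulr1.
have eps0 : eps != 0 by case: epsP => ->; rewrite ?oppr_eq0 oner_neq0.
apply: (mulfI eps0).
suff -> : eps * coxeter_alternant e t = \det ((fourier_mx *t (1%:M : 'M[C]_m))
    *m blockdiag_mx (fun b => \matrix_(i, k) (t i ^+ b * (t i ^+ n) ^ q b k))).
  rewrite det_mulmx det_blockdiag !(mulrA eps) eps2 mul1r -mulrA; congr (_ * _).
  rewrite -big_split; apply: eq_bigr => b _ /=.
  have -> : \prod_i t i ^+ b = \det (dg (fun i => t i ^+ b)).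
    by rewrite det_diag; apply: eq_bigr => i _; rewrite mxE.
  rewrite -det_mulmx; congr (\det _); apply/matrixP => i k.
  by rewrite mul_diag_mx !mxE.
rewrite /coxeter_alternant -E; congr (\det _); apply/matrixP => r s.
case: (mxtens_indexP r) => a i; case: (mxtens_indexP s) => b k.
rewrite !mxE /h /f !mxtens_indexK /= eg /coxeter_torus !mxtens_indexK /=.
rewrite (bigD1 (mxtens_index (b, i))) //= big1 => [|j].
  rewrite addr0 tensmxE !mxE !mxtens_indexK /= !eqxx mulr1.
  set x := n%:Z * q b k + b%:Z; have xb : (x == b %[mod n])%Z.
    by rewrite /x mulrC modzMDl.
  rewrite [LHS](expfzMl (t i) (z a) x) (z_expz a xb) mulrC; congr (_ * _).
  by rewrite /x expfzDr // mulrC -exprz_exp.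
case: (mxtens_indexP j) => b' i'.
rewrite (inj_eq (can_inj (@mxtens_indexK _ _))) xpair_eqE tensmxE !mxE !mxtens_indexK /=.
case: eqP => [->|_ _]; last by rewrite mulr0.
by move=> /= /negPf ii; rewrite (eq_sym i) ii mulr0 mul0r.
Qed.

End Distributed.

(** A nonzero term in the Leibniz expansion of det B is a permutation sending each row (i, a) to a
    column whose exponent has residue a. Being bijective, it puts exactly m columns in each residue
    class. *)
Lemma coxeter_alternant_equidistributed (e : 'I_(m * n) -> int) t :
  coxeter_alternant e t != 0 -> (forall i, t i != 0) ->
  equidistributed m n [seq e j | j : 'I_(m * n)].
Proof.
move=> ne0 t0.
pose B : 'M[C]_(m * n) := \matrix_(r, c)
  if (e c == (mxtens_unindex r).2 %[mod n])%Z then t (mxtens_unindex r).1 ^ e c else 0.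
have E : coxeter_alternant e t = \det ((1%:M : 'M[C]_m) *t fourier_mx) * \det B.
  rewrite -det_mulmx; congr (\det _); apply/matrixP => r c.
  case: (mxtens_indexP r) => i a; rewrite !mxE /coxeter_torus !mxtens_indexK /=.
  have b_lt : (`|(e c %% n)%Z| < n)%N.
    by rewrite -ltz_nat gez0_abs ?modz_ge0 ?ltz_pmod // eqz_nat -lt0n.
  pose b := Ordinal b_lt.
  have bE : (e c == b %[mod n])%Z.
    by rewrite /= gez0_abs ?modz_ge0 ?modz_mod // eqz_nat -lt0n.
  rewrite (bigD1 (mxtens_index (i, b))) //= big1 => [|j].
    rewrite addr0 tensmxE !mxE !mxtens_indexK bE eqxx mul1r.
    by rewrite [LHS](expfzMl (t i) (z a) (e c)) (z_expz a bE) mulrC.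
  case: (mxtens_indexP j) => i' b'.
  rewrite (inj_eq (can_inj (@mxtens_indexK _ _))) xpair_eqE tensmxE !mxE.
  rewrite !mxtens_indexK /=; case: (eqVneq i' i) => [->|ii] /=; last first.
    by rewrite !mul0r.
  case: ifP => [eb'|_ _]; last by rewrite mulr0.
  case/eqP; apply/val_inj; move: eb'; rewrite (eqP bE) !modz_ord.
  by rewrite eqz_nat => /eqP.
have /existsP[s /prodf_neq0 sB] : [exists s : 'S_(m * n), \prod_r B r (s r) != 0].
  apply: contraNT ne0 => /existsPn B0; rewrite E [\det B]big1 ?mulr0 // => s _.
  by have := B0 s; rewrite negbK => /eqP->; rewrite mulr0.
have {}sB i b : (e (s (mxtens_index (i, b))) == b %[mod n])%Z.
  have := sB (mxtens_index (i, b)) isT; rewrite mxE mxtens_indexK /=.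
  by case: ifP => //; rewrite eqxx.
move=> r; rewrite count_map -size_filter.
transitivity (size [seq s (mxtens_index (i, r)) | i <- enum 'I_m]); last first.
  by rewrite size_map size_enum_ord.
apply/perm_size/uniq_perm.
- by rewrite filter_uniq // enum_uniq.
- rewrite map_inj_uniq ?enum_uniq // => i i' /perm_inj.
  by move=> /(can_inj (@mxtens_indexK _ _)) [].
move=> c; rewrite mem_filter mem_enum andbT /=.
apply/idP/mapP => [er|[i _ ->]]; last exact: sB.
have := sB (mxtens_unindex (s^-1%g c)).1 (mxtens_unindex (s^-1%g c)).2.
rewrite -surjective_pairing mxtens_unindexK permKV (eqP er) !modz_ord eqz_nat.
move=> /eqP/val_inj br; exists (mxtens_unindex (s^-1%g c)).1; rewrite ?mem_enum //.
by rewrite [in RHS]br -surjective_pairing mxtens_unindexK permKV.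
Qed.
End CoxeterElement.

Lemma delta_dec (N : nat) (lam : 'I_N -> int) : non_increasing lam ->
  injective (fun j => lam j + delta j).
Proof.
move=> ni i j /eqP; apply: contraTeq => ij.
wlog lt : i j ij / (i < j)%N.
  move=> W; case: (ltngtP i j) ij => [lt|lt|/val_inj->] ij; last by rewrite eqxx in ij.
    exact: W.
  by rewrite eq_sym; apply: W => //; rewrite eq_sym.
have := ni i j (ltnW lt); rewrite /delta; have := ltn_ord j; lia.
Qed.

(** * Characters at the product with the Coxeter element *)

Section CoxeterCharacter.
Variables (C : numClosedFieldType) (m n : nat) (z : 'I_n -> C).
Hypotheses (n_gt0 : (0 < n)%N) (m_gt0 : (0 < m)%N).
Hypotheses (z_inj : injective z) (z_root : forall a, z a ^+ n = 1).
Variables (Q c : 'M[C]_n).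
Local Notation dg t := (diag_mx (\row_i t i)).
Hypotheses (Qu : Q \in unitmx) (cE : c = Q *m dg z *m invmx Q).
Variables (pi : gl_rep C (m * n)) (lam : 'I_(m * n) -> int).
Hypotheses (pi_irr : gl_irreducible pi) (pi_hw : has_highest_weight pi lam).
Local Notation e := (fun j => lam j + delta j).
Local Notation e0 := (fun j : 'I_(m * n) => (stair j)%:Z).

Lemma coxeter_unit : c \in unitmx.
Proof.
rewrite cE !unitmx_mul unitmx_inv Qu diag_unit // => a; exact: z_neq0.
Qed.

Lemma character_coxeter_torus t : (forall i, t i != 0) ->
  gl_character pi (dg t *t c) * coxeter_alternant z e0 t = coxeter_alternant z e t.
Proof.
move=> t0; rewrite cE (character_tens_class n_gt0 m_gt0 z_root) //.
apply: (weyl_character_torus pi_irr pi_hw) => r.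
by rewrite mulf_neq0 // z_neq0.
Qed.

Definition power_vandermonde (t : 'I_m -> C) : C :=
  \det (\matrix_(i, k) (t i ^+ n) ^+ stair k).

Lemma stair_distributed :
  exists2 eps : C, eps = 1 \/ eps = -1 & forall t, (forall i, t i != 0) ->
    coxeter_alternant z e0 t = eps *
     (\det (fourier_mx z *t (1%:M : 'M[C]_m)) * \prod_(b < n) \prod_i t i ^+ b) *
     power_vandermonde t ^+ n.
Proof.
(* The exponent n (m - 1 - k) + b of the staircase sits at the position counted from the end by that
   same number, hence the two reversals. *)
pose g (b : 'I_n) (k : 'I_m) := rev_ord (mxtens_index (rev_ord k, b)).
have [b k|b k k' [E]|eps epsP H] := @coxeter_alternant_distributed C m n z
    n_gt0 z_root e0 g (fun _ k => (stair k)%:Z).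
- by rewrite /g /stair /=; have := ltn_ord b; have := ltn_ord k; nia.
- exact: (decreasing_inj (@stair_dec m) E).
by exists eps => // t /H ->; rewrite prodr_const card_ord.
Qed.

Section Distributed.
Variables (g : 'I_n -> 'I_m -> 'I_(m * n)) (q : 'I_n -> 'I_m -> int).
Hypothesis eg : forall b k, e (g b k) = n%:Z * q b k + b%:Z.
Hypothesis q_inj : forall b, injective (q b).

Lemma fourier_factor_neq0 (t : 'I_m -> C) : (forall i, t i != 0) ->
  \det (fourier_mx z *t (1%:M : 'M[C]_m)) * \prod_(b < n) \prod_i t i ^+ b != 0.
Proof.
move=> t0; rewrite mulf_neq0 //.
  rewrite -unitfE -unitmxE tensmx_unit ?unitmx1 ?fourier_unit // -lt0n //.
apply/prodf_neq0 => b _; apply/prodf_neq0 => i _; exact: expf_neq0.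
Qed.

(** In the ratio of the alternants for [e] and for delta the common Fourier factor cancels, leaving
    the product of the two signs. *)
Lemma character_coxeter_distributed : exists2 eps : C, eps = 1 \/ eps = -1 &
  forall t, (forall i, t i != 0) ->
    gl_character pi (dg t *t c) * power_vandermonde t ^+ n
    = eps * \prod_b \det (\matrix_(i, k) (t i ^+ n) ^ q b k).
Proof.
have [eps epsP H] := coxeter_alternant_distributed n_gt0 z_root eg q_inj.
have [eps0 eps0P H0] := stair_distributed.
exists (eps * eps0) => [|t t0].
  by case: epsP eps0P => -> [] ->; rewrite ?mulrNN ?mul1r ?mulr1; [left|right|right|left].
have := character_coxeter_torus t0; rewrite H // H0 //.
have := fourier_factor_neq0 t0; set K := _ * _ => K0.
have e00 : eps0 != 0 by case: eps0P => ->; rewrite ?oppr_eq0 oner_neq0.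
have e02 : eps0 * eps0 = 1 by case: eps0P => ->; rewrite ?mulrNN mulr1.
set V := _ ^+ n; set D := \prod_b _; set X := gl_character _ _ => E.
apply: (mulfI (mulf_neq0 e00 K0)).
transitivity (X * (eps0 * K * V)); first by ring.
rewrite E; transitivity (eps * K * D * (eps0 * eps0)); last by ring.
by rewrite e02 mulr1.
Qed.

(** At t_i = y^i with y^n = 2 one has t_i^n = 2^i, so all n alternants are at once Vandermonde
    determinants in the numbers 2^(q b k), distinct for fixed b. *)
Lemma character_coxeter_neq0 : exists2 t : 'I_m -> C,
  (forall i, t i != 0) & gl_character pi (dg t *t c) != 0.
Proof.
pose y : C := n.-root 2%:R; have yn : y ^+ n = 2%:R by rewrite /y rootCK.
have y0 : y != 0.
  apply: contra_eq_neq yn => ->; rewrite expr0n gtn_eqF // eq_sym pnatr_eq0 //.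
pose t (i : 'I_m) := y ^+ i; have t0 i : t i != 0 by rewrite expf_neq0.
exists t => //; have [eps epsP /(_ t t0) H] := character_coxeter_distributed.
apply: contra_eq_neq H => ->; rewrite mul0r eq_sym mulf_neq0 //.
  by case: epsP => ->; rewrite ?oppr_eq0 oner_neq0.
apply/prodf_neq0 => b _.
have -> : \matrix_(i, k) (t i ^+ n) ^ q b k
    = Vandermonde m (\row_k (2%:R : C) ^ q b k).
  apply/matrixP => i k; rewrite !mxE /t -exprM mulnC exprM yn.
  by rewrite !exprnP exprz_exp mulrC -exprz_exp.
rewrite det_Vandermonde; apply/prodf_neq0 => i _; apply/prodf_neq0 => j ij.
rewrite !mxE subr_eq0; apply: contraTneq ij => E.
suff -> : j = i by rewrite ltnn.
(* Injectivity of k -> 2^k on the integers comes from the order, so it is checked over the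
   rationals. *)
have ratE (k : int) : (2%:R : C) ^ k = ratr ((2%:R : rat) ^ k).
  by rewrite fmorphXz /= ratr_nat.
move: E; rewrite !ratE => /fmorph_inj.
by move=> /(ieexprIz (x := 2%:R : rat) isT isT)/q_inj.
Qed.
End Distributed.

(** [g b] enumerates the m positions whose entry has residue b, and [q] is the Euclidean quotient
    there; its injectivity comes from that of lam + delta. *)
Lemma equidistributed_exists : equidistributed m n (shifted_entries lam) ->
  exists (g : 'I_n -> 'I_m -> 'I_(m * n)) (q : 'I_n -> 'I_m -> int),
    (forall b k, e (g b k) = n%:Z * q b k + b%:Z) /\ (forall b, injective (q b)).
Proof.
move=> eqd.
have e_inj := delta_dec pi_hw.1.
pose S (b : 'I_n) := [seq j <- enum 'I_(m * n) | (e j == b %[mod n])%Z].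
have sS b : size (S b) = m by rewrite -[RHS](eqd b) count_map -size_filter.
have uS b : uniq (S b) by apply: filter_uniq; apply: enum_uniq.
have N_gt0 : (0 < m * n)%N by rewrite muln_gt0 m_gt0.
pose g b (k : 'I_m) := nth (Ordinal N_gt0) (S b) k.
have gS b k : g b k \in S b by rewrite mem_nth // sS.
have gE b k : e (g b k) = n%:Z * (e (g b k) %/ n)%Z + b%:Z.
  have := gS b k; rewrite mem_filter => /andP[/eqP eb _].
  by rewrite {1}(divz_eq (e (g b k)) n) eb modz_ord mulrC.
exists g, (fun b k => (e (g b k) %/ n)%Z); split=> // b k k' E.
have /e_inj/eqP : e (g b k) = e (g b k') by rewrite gE E -gE.
by rewrite nth_uniq ?sS // => /eqP; apply: val_inj.
Qed.

Lemma regular_tens : regular (fun t : 'M[C]_m => gl_character pi (t *t c)).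
Proof.
pose Phi : 'M[{mpoly C[m * m]}]_(m * n) := generic_mx C m *t map_mx (@mpolyC _ C) c.
have PhiE t : polymap Phi t = t *t c.
  rewrite /polymap map_mxT generic_mxE -map_mx_comp; congr (_ *t _).
  by apply/matrixP => i j; rewrite mxE /= mevalC.
have [t tu|p [r H]] := regular_comp (Phi := Phi) _ (regular_character pi).
  by rewrite PhiE tens_unit // coxeter_unit.
by exists p, r => t tu; rewrite -PhiE; apply: H.
Qed.

Lemma class_function_tens : class_function (fun t : 'M[C]_m => gl_character pi (t *t c)).
Proof.
move=> t h tu hu; pose h' : 'M[C]_(m * n) := h *t (1%:M : 'M[C]_n).
have h'u : h' \in unitmx by rewrite tens_unit ?unitmx1.
have tcu : t *t c \in unitmx by rewrite tens_unit ?coxeter_unit.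
rewrite -(class_function_character pi tcu h'u).
congr gl_character; apply: (can_inj (mulmxK h'u)); rewrite mulmxKV //.
by rewrite /h' !tensmx_mul mul1mx mulmx1 mulmxKV.
Qed.

(** Written as an alternant with exponents n (m - 1 - k), so that its nonvanishing is read off one
    coefficient. *)
Definition power_vandermonde_poly : {mpoly C[m]} :=
  alternant C (fun k : 'I_m => n * stair k)%N.

Lemma power_vandermonde_polyE t :
  power_vandermonde_poly.@[t] = power_vandermonde t.
Proof.
rewrite alternant_eval; congr (\det _); apply/matrixP => i k.
by rewrite !mxE exprM.
Qed.

Lemma power_vandermonde_poly_neq0 : power_vandermonde_poly != 0.
Proof.
have nstair_inj : injective (fun k : 'I_m => n * stair k)%N.
  move=> i j /eqP; rewrite eqn_pmul2l // => /eqP.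
  exact: (decreasing_inj (@stair_dec m)).
apply/eqP => V0; have := mcoeff_alternant C nstair_inj.
by rewrite -/power_vandermonde_poly V0 mcoeff0 => /esym/eqP; rewrite oner_eq0.
Qed.

(** Where the Vandermonde in the t_i^n is nonzero so is the alternant of delta; a nonzero character
    value would make the alternant of lam + delta nonzero and force equidistribution. *)
Lemma character_coxeter_vanish : ~ equidistributed m n (shifted_entries lam) ->
  forall t : 'M[C]_m, t \in unitmx -> gl_character pi (t *t c) = 0.
Proof.
move=> neqd; apply: (class_function_eq0 regular_tens class_function_tens
  power_vandermonde_poly_neq0) => t t0; rewrite power_vandermonde_polyE => V0.
apply/eqP; apply: contra_notT neqd => X0.
have [eps0 eps0P H0] := stair_distributed.
have ne0 : coxeter_alternant z e t != 0.
  rewrite -character_coxeter_torus // mulf_neq0 // H0 //.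
  rewrite mulf_neq0 ?expf_neq0 // mulf_neq0 ?fourier_factor_neq0 //.
  by case: eps0P => ->; rewrite ?oppr_eq0 oner_neq0.
exact: (coxeter_alternant_equidistributed n_gt0 z_root ne0 t0).
Qed.

Section Factorization.
Variables (mu : 'I_n -> 'I_m -> int) (pi_ : 'I_n -> gl_rep C m).
Hypothesis muP : forall i : 'I_n, is_quotient_weight n i (shifted_entries lam) (mu i).
Hypothesis irr_ : forall i : 'I_n, gl_irreducible (pi_ i).
Hypothesis hw_ : forall i : 'I_n, has_highest_weight (pi_ i) (mu i).

(** Every entry of mu_b + delta_m is some (a - b) / n with a an entry of lam + delta; [g] records
    the position of such an a. *)
Lemma quotient_weight_exists : exists g : 'I_n -> 'I_m -> 'I_(m * n),
  forall b k, e (g b k) = n%:Z * (mu b k + delta k) + b%:Z.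
Proof.
suff H (bk : 'I_n * 'I_m) : exists j,
    e j = n%:Z * (mu bk.1 bk.2 + delta bk.2) + (bk.1)%:Z.
  by have [g gE] := fin_all_exists H; exists (fun b k => g (b, k)) => b k; rewrite gE.
case: bk => b k /=.
have : (mu b k + delta k)%:Q \in [seq a%:Q | a <- shifted_entries (mu b)].
  by apply/mapP; exists (mu b k + delta k) => //; apply: map_f; rewrite mem_enum.
rewrite muP mem_sort mem_filter => /andP[_ /mapP[a /mapP[j _ ->]]] E.
exists j; apply: (@intr_inj rat).
have n0 : n%:Q != 0 :> rat by rewrite intr_eq0 eqz_nat -lt0n.
move/(congr1 (fun x => x * n%:Q)): E; rewrite mulfVK // => E.
by rewrite [RHS]rmorphD rmorphM /= mulrC E -rmorphD subrK.
Qed.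

Lemma regular_power (rho : gl_rep C m) :
  regular (fun t : 'M[C]_m => gl_character rho (t ^+ n)).
Proof.
have PhiE t : polymap (generic_mx C m ^+ n) t = t ^+ n.
  elim: (n) => [|k IH]; first by rewrite !expr0 /polymap map_mx1.
  by rewrite !exprS -IH /polymap map_mxM generic_mxE.
have [t tu|p [r H]] := regular_comp (Phi := generic_mx C m ^+ n) _ (regular_character rho).
  rewrite PhiE; elim: (n) => [|k IH]; first by rewrite expr0 unitmx1.
  by rewrite exprS unitmx_mul tu.
by exists p, r => t tu; rewrite -PhiE; apply: H.
Qed.

Lemma class_function_power (rho : gl_rep C m) :
  class_function (fun t : 'M[C]_m => gl_character rho (t ^+ n)).
Proof.
move=> t h tu hu; have tn k : t ^+ k \in unitmx.
  by elim: k => [|k IH]; rewrite ?expr0 ?unitmx1 // exprS unitmx_mul tu.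
have -> k : (h *m t *m invmx h) ^+ k = h *m (t ^+ k) *m invmx h.
  elim: k => [|k IH]; first by rewrite !expr0 mulmx1 mulmxV.
  by rewrite !exprS IH -!mulmxE !mulmxA mulmxKV.
exact: class_function_character.
Qed.

(** The Weyl formula for each pi_b at diag(t_i^n) has the Vandermonde in the t_i^n as denominator,
    and the n of them make up the power on the left of [character_coxeter_distributed]. The sign is
    fixed there before t varies. *)
Lemma character_coxeter_factor : exists eps : C, (eps = 1 \/ eps = -1) /\
  forall t : 'M[C]_m, t \in unitmx ->
    gl_character pi (t *t c) = eps * \prod_(i < n) gl_character (pi_ i) (t ^+ n).
Proof.
have [g gE] := quotient_weight_exists.
have q_inj b := delta_dec (hw_ b).1.
have [eps epsP H] := character_coxeter_distributed gE q_inj.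
exists eps; split=> // t tu; apply/eqP; rewrite -subr_eq0; apply/eqP.
move: t tu; apply: (@class_function_eq0 _ _ _ power_vandermonde_poly).
- apply: regularB; first exact: regular_tens.
  apply: regularM; first exact: regular_cst.
  by apply: regular_prod => i; apply: regular_power.
- move=> t h tu hu; rewrite class_function_tens //; congr (_ - _ * _).
  by apply: eq_bigr => i _; rewrite class_function_power.
- exact: power_vandermonde_poly_neq0.
move=> t t0; rewrite power_vandermonde_polyE => V0.
apply/eqP; rewrite subr_eq0 -(inj_eq (mulIf (expf_neq0 n V0))) H //.
have -> : power_vandermonde t ^+ n = \prod_(b < n) power_vandermonde t.
  by rewrite prodr_const card_ord.
rewrite -mulrA -big_split; apply/eqP; congr (_ * _); apply: eq_bigr => b _ /=.
have -> : dg t ^+ n = dg (fun i => t i ^+ n).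
  elim: (n) => [|k IH].
    by apply/matrixP => i j; rewrite !mxE.
  rewrite exprS IH -mulmxE; apply/matrixP => i j; rewrite mul_diag_mx !mxE exprS.
  by case: eqP; rewrite ?mulr1n ?mulr0n ?mulr0.
by rewrite -(weyl_character_torus (irr_ b) (hw_ b)) // => i; apply: expf_neq0.
Qed.
End Factorization.
End CoxeterCharacter.

Theorem theorem2 (R : realType) (m n : nat) (m_gt0 : (0 < m)%N) (n_gt0 : (0 < n)%N)
  (c : 'M[R[i]]_n) (c_coxeter : coxeter_class c)
  (pi : gl_rep R[i] (m * n)) (lam : 'I_(m * n) -> int)
  (pi_irr : gl_irreducible pi) (pi_hw : has_highest_weight pi lam) :
  (~ (forall t : 'M[R[i]]_m, t \in unitmx -> gl_character pi (t *t c) = 0)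
   <-> equidistributed m n (shifted_entries lam))
  /\
  (equidistributed m n (shifted_entries lam) ->
   forall (mu : 'I_n -> 'I_m -> int) (pi_ : 'I_n -> gl_rep R[i] m),
     (forall i : 'I_n, is_quotient_weight n i (shifted_entries lam) (mu i)) ->
     (forall i : 'I_n, gl_irreducible (pi_ i)) ->
     (forall i : 'I_n, has_highest_weight (pi_ i) (mu i)) ->
     exists eps : R[i], (eps = 1 \/ eps = -1) /\
       forall t : 'M[R[i]]_m, t \in unitmx ->
         gl_character pi (t *t c)
         = eps * \prod_(i < n) gl_character (pi_ i) (t ^+ n)).
Proof.
have [|z [z_inj z_root]] := @exists_unity_roots R[i] n n_gt0.
  by rewrite pnatr_eq0 -lt0n.
have [Q Qu cE] := coxeter_class_diag z_inj z_root c_coxeter.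
split; last first.
  move=> _ mu pi_ muP irr_ hw_.
  exact: (character_coxeter_factor n_gt0 m_gt0 z_inj z_root Qu cE pi_irr pi_hw muP irr_ hw_).
split=> [nvan|/(equidistributed_exists n_gt0 m_gt0 pi_hw)[g [q [gE q_inj]]] van].
  apply: contra_notP nvan => neqd.
  exact: (character_coxeter_vanish n_gt0 m_gt0 z_inj z_root Qu cE pi_irr pi_hw neqd).
have [t t0] := character_coxeter_neq0 n_gt0 m_gt0 z_inj z_root Qu cE pi_irr pi_hw gE q_inj.
by rewrite van ?eqxx // diag_unit.
Qed.
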